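(* Let $(\mathfrak{A},\alpha)$ and $(\mathfrak{B},\beta)$ be $\mathbb{Z}_2$-graded $C^*$-algebras, with $\alpha=\mathrm{ad}_u$ for some selfadjoint unitary $u\in\mathfrak{A}$. Then the $\mathbb{Z}_2$-graded Fermi $C^*$-tensor product $(\mathfrak{A}\otimes_{F}\mathfrak{B},\ \alpha\otimes_{F}\beta)$ is $*$-isomorphic, as a $\mathbb{Z}_2$-graded $C^*$-algebra (i.e. via a $*$-isomorphism intertwining the gradings), to the $\mathbb{Z}_2$-graded tensor product $(\mathfrak{A}\otimes_{X}\mathfrak{B},\ \alpha\otimes_{X}\beta)$.
   Context: All $C^*$-algebras are unital. A $\mathbb{Z}_2$-graded $C^*$-algebra $(\mathfrak{A},\alpha)$ is a $C^*$-algebra with a $*$-automorphism $\alpha$ satisfying $\alpha^2=\mathrm{id}$. Put $\mathfrak{A}_\pm=\{a:\alpha(a)=\pm a\}$ (even/odd, the homogeneous elements), so each $a$ decomposes as $a=a_++a_-$. A state $\varphi$ is even if $\varphi\circ\alpha=\varphi$; $\mathcal{S}_+(\mathfrak{A})$ is the set of even states. $\mathrm{ad}_u(a)=uau^*$. Fermi tensor product: on the algebraic tensor product $\mathfrak{A}\odot\mathfrak{B}$, for homogeneous elements put $\epsilon(x,y)=-1$ if $x$ and $y$ are both odd, $\epsilon(x,y)=1$ otherwise, and define product and involution by (bi)linear/antilinear extension of $(a\odot b)(a'\odot b')=\epsilon(b,a')\,aa'\odot bb'$ and $(a\odot b)^*=\epsilon(a,b)\,a^*\odot b^*$. For even states $\omega\in\mathcal{S}_+(\mathfrak{A})$,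 $\varphi\in\mathcal{S}_+(\mathfrak{B})$ the product functional $(\omega\times\varphi)(a\odot b)=\omega(a)\varphi(b)$ is a state on this $*$-algebra. The minimal norm is $\|x\|=\sup\{\|\pi_{\omega\times\varphi}(x)\|:\omega\in\mathcal{S}_+(\mathfrak{A}),\varphi\in\mathcal{S}_+(\mathfrak{B})\}$, with $\pi_{\omega\times\varphi}$ the GNS representation; $\mathfrak{A}\otimes_F\mathfrak{B}$ is the completion, $a\otimes_F b$ denotes the image of $a\odot b$, and $\alpha\otimes_F\beta$ is the grading determined by $a\otimes_F b\mapsto\alpha(a)\otimes_F\beta(b)$. $\mathfrak{A}\otimes_X\mathfrak{B}$ is the usual minimal $C^*$-tensor product, with grading $\alpha\otimes_X\beta$ determined by $a\otimes_X b\mapsto\alpha(a)\otimes_X\beta(b)$. *)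

(* Defs.v *)
From HB Require Import structures.
From mathcomp Require Import all_boot all_order all_algebra.
From mathcomp Require Import sesquilinear.
From mathcomp Require Import complex.
From mathcomp Require Import all_classical all_reals.
From mathcomp Require Import ereal topology normedtype.

Set Implicit Arguments.
Unset Strict Implicit.
Unset Printing Implicit Defensive.

Import Order.TTheory GRing.Theory Num.Theory.
Import numFieldNormedType.Exports.

Local Open Scope classical_set_scope.
Local Open Scope complex_scope.
Local Open Scope ring_scope.

(* Norms of R[i]-modules take their values in R[i]; Re brings them back to R.
   As 0 <= z in R[i] means that z is a nonnegative real, positivity of
   functionals needs no further condition. *)

HB.mixin Record isStarAlgebra (R : realType) (A : Type)
    of GRing.Algebra R[i] A := {
  star : A -> A ;
  starK : involutive star ;
  starD : {morph star : x y / x + y} ;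
  starZ : forall (c : R[i]) (x : A), star (c *: x) = Num.conj c *: star x ;
  starM : forall x y : A, star (x * y) = star y * star x
}.

#[short(type="starAlgType")]
HB.structure Definition StarAlgebra (R : realType) :=
  {A of GRing.Algebra R[i] A & isStarAlgebra R A}.

(* The norm is not the one of normedModType: Hierarchy Builder rejects a
   structure below both rings and normed modules which is not a numDomainType,
   for want of a join declared before numDomainType. *)
HB.mixin Record isCStarAlgebra (R : realType) (A : Type)
    of StarAlgebra R A := {
  cnorm : A -> R ;
  cnorm_eq0 : forall x : A, cnorm x = 0 -> x = 0 ;
  cnormD_le : forall x y : A, cnorm (x + y) <= cnorm x + cnorm y ;
  cnormZ : forall (c : R[i]) (x : A), cnorm (c *: x) = complex.Re `|c| * cnorm x ;
  cnormM_le : forall x y : A, cnorm (x * y) <= cnorm x * cnorm y ;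
  cnorm_star_mul : forall x : A, cnorm (star x * x) = cnorm x ^+ 2 ;
  cnorm_complete : forall x : nat -> A,
    (forall e : R, 0 < e -> exists N : nat, forall m n : nat,
       (N <= m)%N -> (N <= n)%N -> cnorm (x m - x n) < e) ->
    exists y : A, forall e : R, 0 < e -> exists N : nat, forall n : nat,
       (N <= n)%N -> cnorm (x n - y) < e
}.

#[short(type="cstarAlgType")]
HB.structure Definition CStarAlgebra (R : realType) :=
  {A of StarAlgebra R A & isCStarAlgebra R A}.

HB.mixin Record isGraded (R : realType) (A : Type) of CStarAlgebra R A := {
  grading : A -> A ;
  grading_linear : linear grading ;
  gradingM : {morph grading : x y / x * y} ;
  grading_star : {morph grading : x / star x} ;
  gradingK : involutive grading
}.

#[short(type="gradedCStarAlgType")]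
HB.structure Definition GradedCStarAlgebra (R : realType) :=
  {A of CStarAlgebra R A & isGraded R A}.

HB.mixin Record isHilbert (R : realType) (H : Type)
    of CompleteNormedModule R[i] H := {
  inner : {dot H for (@Num.conj R[i])} ;
  norm_inner : forall v : H, `|v| ^+ 2 = inner v v
}.

#[short(type="hilbertType")]
HB.structure Definition Hilbert (R : realType) :=
  {H of CompleteNormedModule R[i] H & isHilbert R H}.

Notation "''[' v , w ]" := (inner v w)
  (at level 0, format "''[' v ,  w ]") : ring_scope.

Section Gradings.
Variable R : realType.

Definition even (A : gradedCStarAlgType R) (a : A) := grading a == a.

Definition odd (A : gradedCStarAlgType R) (a : A) := grading a == - a.

Definition homogeneous (A : gradedCStarAlgType R) (a : A) := even a || odd a.

Definition eps (A B : gradedCStarAlgType R) (a : A) (b : B) : R[i] :=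
  if odd a && odd b then - 1 else 1.

Definition inner_grading (A : gradedCStarAlgType R) (u : A) :=
  [/\ star u = u, u * star u = 1, star u * u = 1 &
      forall a : A, grading a = u * a * star u].

Definition graded_isomorphic (A B : gradedCStarAlgType R) :=
  exists theta : {lrmorphism A -> B},
    [/\ bijective theta,
        forall a, theta (star a) = star (theta a) &
        forall a, theta (grading a) = grading (theta a)].

End Gradings.

Section States.
Variable R : realType.

Definition is_state (A : starAlgType R) (w : {scalar A}) :=
  (forall a : A, 0 <= w (star a * a)) /\ w 1 = 1.

Definition is_even_state (A : gradedCStarAlgType R) (w : {scalar A}) :=
  is_state w /\ forall a : A, w (grading a) = w a.

Definition opnorm (H : hilbertType R) (f : H -> H) : \bar R :=
  ereal_sup [set (complex.Re `|f v|)%:E | v in [set v : H | `|v| <= 1]].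

Definition is_representation (T : starAlgType R) (H : hilbertType R)
    (pi : T -> {linear H -> H}) :=
  [/\ forall x, continuous (pi x),
      forall (c : R[i]) x y v, pi (c *: x + y) v = c *: pi x v + pi y v,
      forall x y v, pi (x * y) v = pi x (pi y v),
      forall v, pi 1 v = v &
      forall x v w, '[pi (star x) v, w] = '[v, pi x w]].

Definition is_GNS (T : starAlgType R) (psi : {scalar T}) (H : hilbertType R)
    (pi : T -> {linear H -> H}) (xi : H) :=
  [/\ is_representation pi,
      dense (range (fun x => pi x xi)) &
      forall x, psi x = '[pi x xi, xi]].

End States.

Section TensorProducts.
Variable R : realType.

(* Spanning stands for the uniqueness half of the universal property. *)
Definition is_algebraic_tensor (U V T : lmodType R[i])
    (tau : {bilinear U -> V -> T}) :=
  (forall x : T, exists s : seq (U * V), x = \sum_(p <- s) tau p.1 p.2) /\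
  (forall (W : lmodType R[i]) (f : {bilinear U -> V -> W}),
     exists g : {linear T -> W}, forall u v, g (tau u v) = f u v).

Definition is_hilbert_tensor (H1 H2 K : hilbertType R)
    (t : {bilinear H1 -> H2 -> K}) :=
  (forall v1 w1 v2 w2, '[t v1 v2, t w1 w2] = '[v1, w1] * '[v2, w2]) /\
  dense [set z : K | exists s : seq (H1 * H2), z = \sum_(p <- s) t p.1 p.2].

(* Hausdorff completion with respect to the C*-seminorm N, with its canonical
   map; that N is finite is part of the equality. *)
Definition is_cstar_completion (T : starAlgType R) (N : T -> \bar R)
    (C : cstarAlgType R) (iota : {lrmorphism T -> C}) :=
  [/\ forall x, iota (star x) = star (iota x),
      forall x, (cnorm (iota x))%:E = N x &
      forall (c : C) (e : R), 0 < e -> exists x : T, cnorm (c - iota x) < e].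

Section Norms.
Variables (A B : gradedCStarAlgType R) (T : starAlgType R).
Variable tau : {bilinear A -> B -> T}.

Definition fermi_norm (x : T) : \bar R :=
  ereal_sup [set r : \bar R |
    exists (w : {scalar A}) (phi : {scalar B}) (psi : {scalar T})
           (H : hilbertType R) (pi : T -> {linear H -> H}) (xi : H),
    [/\ is_even_state w, is_even_state phi,
        forall a b, psi (tau a b) = w a * phi b,
        is_GNS psi pi xi &
        r = opnorm (pi x)]].

(* rho is the representation pi1 (x) pi2 on K = H1 (x) H2. *)
Definition spatial_norm (x : T) : \bar R :=
  ereal_sup [set r : \bar R |
    exists (H1 H2 K : hilbertType R) (pi1 : A -> {linear H1 -> H1})
           (pi2 : B -> {linear H2 -> H2}) (t : {bilinear H1 -> H2 -> K})
           (rho : T -> {linear K -> K}),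
    [/\ is_representation pi1 /\ is_representation pi2,
        is_hilbert_tensor t,
        is_representation rho,
        forall a b v1 v2, rho (tau a b) (t v1 v2) = t (pi1 a v1) (pi2 b v2) &
        r = opnorm (rho x)]].

End Norms.

(* The tensor products are only determined up to isomorphism: the records below
   collect the data of an arbitrary model. *)

Record fermiTensor (A B : gradedCStarAlgType R) := FermiTensor {
  fermi_alg : starAlgType R ;
  fermi_pure : {bilinear A -> B -> fermi_alg} ;
  fermi_algP : is_algebraic_tensor fermi_pure ;
  fermi_mul : forall (a a' : A) (b b' : B),
    homogeneous a -> homogeneous a' -> homogeneous b -> homogeneous b' ->
    fermi_pure a b * fermi_pure a' b' =
      eps b a' *: fermi_pure (a * a') (b * b') ;
  fermi_star : forall (a : A) (b : B), homogeneous a -> homogeneous b ->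
    star (fermi_pure a b) = eps a b *: fermi_pure (star a) (star b) ;
  fermi_cstar :> gradedCStarAlgType R ;
  fermi_emb : {lrmorphism fermi_alg -> fermi_cstar} ;
  fermi_embP : is_cstar_completion (fermi_norm fermi_pure) fermi_emb ;
  fermi_grading : forall (a : A) (b : B),
    grading (fermi_emb (fermi_pure a b)) =
      fermi_emb (fermi_pure (grading a) (grading b))
}.

Record minTensor (A B : gradedCStarAlgType R) := MinTensor {
  min_alg : starAlgType R ;
  min_pure : {bilinear A -> B -> min_alg} ;
  min_algP : is_algebraic_tensor min_pure ;
  min_mul : forall (a a' : A) (b b' : B),
    min_pure a b * min_pure a' b' = min_pure (a * a') (b * b') ;
  min_star : forall (a : A) (b : B),
    star (min_pure a b) = min_pure (star a) (star b) ;
  min_cstar :> gradedCStarAlgType R ;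
  min_emb : {lrmorphism min_alg -> min_cstar} ;
  min_embP : is_cstar_completion (spatial_norm min_pure) min_emb ;
  min_grading : forall (a : A) (b : B),
    grading (min_emb (min_pure a b)) =
      min_emb (min_pure (grading a) (grading b))
}.

End TensorProducts.

(* Main.v *)
(* When the grading of A is ad_u, the element u commutes with even elements and
   anticommutes with odd ones, so a (x) b |-> a u^|b| (x) b turns the Fermi
   product and involution into the usual ones: it is a *-isomorphism h of the
   algebraic tensor products.  The two norms correspond under h.

   Fermi <= spatial: if w, phi are even, phi vanishes on odd elements, hence the
   product functional is carried to the functional a (x) b |-> w(a) phi(b); its
   GNS space is the Hilbert tensor product of the closures of (A (x) 1) xi and
   (1 (x) B) xi, on which it acts as a product representation.

   Spatial <= Fermi: let pi1, pi2 act on H1, H2.  Eigenvectors v of pi1(u) give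
   even states of A, and b |-> 2 <b_+ w, w> is an even state of B if |w|^2 = 1/2;
   their product is a vector state in a doubled copy of H1 (x) H2.
   This bounds |pi(x) (v (x) w)| by C N(x), hence |pi(x) z| by C_z N(x) for z in
   a dense subspace, and the C*-identity applied to (x^* x)^(2^n) removes C_z.

   The isomorphism extends to the completions, and it intertwines the gradings
   there because *-homomorphisms of C*-algebras are continuous. *)
Require Import Defs.
From mathcomp Require Import all_boot all_order all_algebra all_reals.
From HB Require Import structures.
From mathcomp Require Import sesquilinear complex.
From mathcomp Require Import all_classical ereal topology normedtype.
From mathcomp Require Import ring lra.
Import Defs.

Set Implicit Arguments.
Unset Strict Implicit.
Unset Printing Implicit Defensive.

Import Order.TTheory GRing.Theory Num.Theory.
Import numFieldNormedType.Exports.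

Local Open Scope classical_set_scope.
Local Open Scope complex_scope.
Local Open Scope ring_scope.

(** * Norms and inner products *)

Section RealNorms.
Variable R : realType.
Local Notation C := R[i].

Definition cabs (c : C) : R := complex.Re `|c|.

Lemma cabsE (c : C) : (cabs c)%:C = `|c|.
Proof. by rewrite RRe_real// normr_real. Qed.

Lemma cabs_ge0 (c : C) : 0 <= cabs c.
Proof. by rewrite -ler0c cabsE. Qed.

Lemma cabs_real (r : R) : 0 <= r -> cabs r%:C = r.
Proof. by move=> r0; apply: complexI; rewrite cabsE ger0_norm// ler0c. Qed.

Lemma ge_cabs_Re (c : C) : complex.Re c <= cabs c.
Proof. by rewrite (le_trans (ler_norm _))// -lecR cabsE normc_ge_Re. Qed.

Lemma Re_ge0K (c : C) : 0 <= c -> (complex.Re c)%:C = c.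
Proof. by move=> c0; rewrite RRe_real// ger0_real. Qed.

Lemma Re_ge0 (c : C) : 0 <= c -> 0 <= complex.Re c.
Proof. by move=> c0; rewrite -ler0c Re_ge0K. Qed.

Lemma Re_gt0 (c : C) : 0 < c -> 0 < complex.Re c.
Proof. by move=> c0; rewrite -ltcR Re_ge0K// ltW. Qed.

Lemma ReD (c d : C) : complex.Re (c + d) = complex.Re c + complex.Re d.
Proof. by case: c d => [a b] [a' b']. Qed.

Lemma ReZ (r : R) (c : C) : complex.Re (r%:C * c) = r * complex.Re c.
Proof. by case: c => a b; simpc. Qed.

(** Norms are bare real-valued functions here. The norm of a C*-algebra, the norm of an inner
    product and the modulus of scalars all fit, so the density arguments below are done once for the
    three of them. *)
Definition is_norm (V : lmodType C) (n : V -> R) :=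
  [/\ forall x y, n (x + y) <= n x + n y,
      forall c x, n (c *: x) = cabs c * n x &
      forall x, n x = 0 -> x = 0].

Definition is_complete (V : lmodType C) (n : V -> R) :=
  forall x : nat -> V,
    (forall e : R, 0 < e -> exists N : nat, forall m n' : nat,
       (N <= m)%N -> (N <= n')%N -> n (x m - x n') < e) ->
    exists y : V, forall e : R, 0 < e -> exists N : nat, forall n' : nat,
       (N <= n')%N -> n (x n' - y) < e.

Section NormTheory.
Variables (V : lmodType C) (n : V -> R).
Hypothesis nP : is_norm n.

Lemma is_normD x y : n (x + y) <= n x + n y. Proof. by case: nP. Qed.

Lemma is_normZ c x : n (c *: x) = cabs c * n x. Proof. by case: nP. Qed.

Lemma is_norm0 : n 0 = 0.
Proof. by rewrite -(scale0r 0) is_normZ /cabs normr0 mul0r. Qed.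

Lemma is_normN x : n (- x) = n x.
Proof. by rewrite -scaleN1r is_normZ /cabs normrN1 mul1r. Qed.

Lemma is_norm_ge0 x : 0 <= n x.
Proof. by have := is_normD x (- x); rewrite subrr is_norm0 is_normN; lra. Qed.

Lemma is_normBC x y : n (x - y) = n (y - x).
Proof. by rewrite -opprB is_normN. Qed.

Lemma is_normB x y : n (x - y) <= n x + n y.
Proof. by rewrite -(is_normN y) is_normD. Qed.

Lemma is_norm_dist z x y : n (x - y) <= n (x - z) + n (z - y).
Proof. by rewrite -[x - y](subrKA z) is_normD. Qed.

Lemma is_norm_small0 x : (forall e, 0 < e -> n x < e) -> x = 0.
Proof.
move=> small; case: nP => _ _; apply; apply/eqP; rewrite eq_le is_norm_ge0 andbT.
by rewrite leNgt; apply/negP => /small; rewrite ltxx.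
Qed.

End NormTheory.

Section DotNorm.
Variables (V : lmodType C) (g : {dot V for (@Num.conj C)}).

Definition dnorm (x : V) : R := Num.sqrt (complex.Re (g x x)).

Lemma dot_ge0 x : 0 <= g x x. Proof. exact: dnorm_ge0. Qed.

Lemma dnormE x : (dnorm x ^+ 2)%:C = g x x.
Proof. by rewrite sqr_sqrtr ?Re_ge0K ?Re_ge0 ?dot_ge0. Qed.

Lemma dnormE_Re x : dnorm x ^+ 2 = complex.Re (g x x).
Proof. by rewrite -dnormE. Qed.

Lemma dotC x y : g x y = Num.conj (g y x).
Proof. by rewrite (hermC g) expr0 mul1r. Qed.

Lemma dotDl x y z : g (x + y) z = g x z + g y z. Proof. exact: linearDl. Qed.
Lemma dotDr x y z : g x (y + z) = g x y + g x z. Proof. exact: linearDr. Qed.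
Lemma dotNl x z : g (- x) z = - g x z. Proof. exact: linearNl. Qed.
Lemma dotNr x z : g x (- z) = - g x z. Proof. exact: linearNr. Qed.
Lemma dotZl c x z : g (c *: x) z = c * g x z. Proof. exact: linearZl_LR. Qed.
Lemma dotZr c x z : g x (c *: z) = Num.conj c * g x z.
Proof. exact: linearZr_LR. Qed.
Lemma dot0r z : g z 0 = 0. Proof. exact: linear0r. Qed.

Lemma dot_CauchySchwarz x y : cabs (g x y) <= dnorm x * dnorm y.
Proof.
rewrite -(@ler_pXn2r _ 2)// ?nnegrE ?cabs_ge0 ?mulr_ge0 ?sqrtr_ge0//.
rewrite exprMn -lecR [leRHS]rmorphM [leLHS]rmorphXn/= cabsE !dnormE.
have [->|y0] := eqVneq y 0; first by rewrite !dot0r normr0 expr0n mulr0.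
have d0 : 0 < g y y by rewrite neq0_dnorm_gt0.
(* The squared norm of [x] minus its projection on [y] is nonnegative; clearing the denominator
   [g y y] gives the squared inequality. *)
have := dot_ge0 (x - (g x y / g y y) *: y).
rewrite dotDl !dotDr !dotNl !dotNr !dotZl !dotZr.
rewrite (dotC y x) rmorphM fmorphV/= (CrealP (ger0_real (ltW d0))).
set a := g x y; set d := g y y; set k := Num.conj a.
rewrite (_ : _ + _ = (g x x * d - a * k) / d); last by field; rewrite gt_eqF.
by rewrite pmulr_lge0 ?invr_gt0// subr_ge0 normCK.
Qed.

Lemma dnorm_is_norm : is_norm dnorm.
Proof.
split=> [x y|c x|x].
- rewrite -(@ler_pXn2r _ 2)// ?nnegrE ?addr_ge0 ?sqrtr_ge0//.
  rewrite sqrrD !dnormE_Re dotDl !dotDr !ReD.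
  have hyx : complex.Re (g y x) = complex.Re (g x y).
    by rewrite dotC; case: (g x y).
  have := le_trans (ge_cabs_Re _) (dot_CauchySchwarz x y); rewrite hyx.
  lra.
- rewrite /dnorm dotZl dotZr mulrA -normCK -cabsE -rmorphXn/= ReZ.
  by rewrite sqrtrM ?sqr_ge0// sqrtr_sqr ger0_norm// cabs_ge0.
- move=> n0; apply: contra_eq n0 => x0.
  by rewrite gt_eqF// sqrtr_gt0 -ltcR Re_ge0K ?dot_ge0// neq0_dnorm_gt0.
Qed.

End DotNorm.
End RealNorms.

Definition mk_linear (K : pzRingType) (U V : lmodType K) (f : U -> V)
    (fP : linear f) : {linear U -> V} :=
  HB.pack f (GRing.isLinear.Build K U V *:%R f fP).

Lemma ltr0Sn_inv (R : realType) (n : nat) : 0 < n.+1%:R^-1 :> R.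
Proof. by rewrite invr_gt0 ltr0Sn. Qed.

Lemma inv_nat_small (R : realType) (e : R) : 0 < e ->
  exists N : nat, forall n, (N <= n)%N -> n.+1%:R^-1 < e.
Proof.
move=> e0; exists (Num.truncn e^-1) => n Nn.
rewrite invf_plt ?posrE ?ltr0Sn//; apply: lt_le_trans (truncnS_gt _) _.
by rewrite ler_nat ltnS.
Qed.

(** * Extension of maps and identities by density *)

Section DenseExtension.
Variables (R : realType) (V S W : lmodType R[i]) (nS : S -> R) (nW : W -> R).
Hypotheses (nSP : is_norm nS) (nWP : is_norm nW).
Variable j : V -> S.
Hypothesis j_dense : forall s (e : R), 0 < e -> exists v, nS (s - j v) < e.

(** Lipschitz bounds stand in for continuity and linearity, so that conjugate-linear maps such as
    [star] are covered as well. *)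
Lemma lipschitz_dense_eq (k k' : R) (f g : S -> W) :
  (forall s s', nW (f s - f s') <= k * nS (s - s')) ->
  (forall s s', nW (g s - g s') <= k' * nS (s - s')) ->
  (forall v, f (j v) = g (j v)) -> f =1 g.
Proof.
move=> fk gk fg s; apply/eqP; rewrite -subr_eq0; apply/eqP.
apply: (is_norm_small0 nWP) => e e0.
(* The Lipschitz constants come without a sign, hence the absolute values; the 1 keeps the divisor
   positive. *)
have k0 : 0 < `|k| + `|k'| + 1 by rewrite ltr_wpDl ?addr_ge0.
have [v sv] := j_dense s (divr_gt0 e0 k0).
apply: le_lt_trans (is_norm_dist nWP (f (j v)) _ _) _; rewrite {2}fg.
rewrite (is_normBC nWP (g _)).
move: sv; rewrite ltr_pdivlMr// => sv.
have h0 := is_norm_ge0 nSP (s - j v).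
have kk : k * nS (s - j v) <= `|k| * nS (s - j v) by rewrite ler_wpM2r// ler_norm.
have kk' : k' * nS (s - j v) <= `|k'| * nS (s - j v) by rewrite ler_wpM2r// ler_norm.
have := fk s (j v); have := gk s (j v); lra.
Qed.

Hypothesis jP : linear j.
Variable f : V -> W.
Hypothesis fP : linear f.
Variable k : R.
Hypotheses (k0 : 0 <= k) (fk : forall v, nW (f v) <= k * nS (j v)).
Hypothesis nW_complete : is_complete nW.

(** The closure in S x W of the set of pairs (j v, f v). It is a linear relation, total because W is
    complete and single-valued because of the bound [fk]; the extension of [f] is the function with
    this graph. *)
Let graph s w :=
  forall e : R, 0 < e -> exists v, nS (s - j v) < e /\ nW (w - f v) < e.

Let graph_linear c s w s' w' :
  graph s w -> graph s' w' -> graph (c *: s + s') (c *: w + w').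
Proof.
move=> sw sw' e e0.
have c0 : 0 < cabs c + 1 by have := cabs_ge0 c; lra.
pose d := e / (cabs c + 1); have d0 : 0 < d by rewrite divr_gt0.
have dE : d * (cabs c + 1) = e by rewrite divfK// gt_eqF.
clearbody d; have [v [sv wv]] := sw _ d0; have [v' [sv' wv']] := sw' _ d0.
have cB (U : lmodType R[i]) (n : U -> R) (nP : is_norm n) x x' y y' :
    n (x - y) < d -> n (x' - y') < d -> n (c *: x + x' - (c *: y + y')) < e.
  rewrite opprD addrACA -scalerBr => h h'.
  have := is_normD nP (c *: (x - y)) (x' - y'); rewrite is_normZ//.
  have := ler_wpM2l (cabs_ge0 c) (ltW h); lra.
by exists (c *: v + v'); rewrite jP fP; split; apply: cB.
Qed.

Let graph_bound s w : graph s w -> nW w <= k * nS s.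
Proof.
move=> sw; apply/ler_addgt0Pr => e e0.
have k1 : 0 < k + 1 := ltr_wpDl k0 ltr01.
pose d := e / (k + 1); have d0 : 0 < d by rewrite divr_gt0.
have dE : d * (k + 1) = e by rewrite divfK// gt_eqF.
clearbody d; have [v [sv wv]] := sw _ d0.
have := is_normD nWP (w - f v) (f v); rewrite subrK => h1.
have := is_normB nSP s (s - j v); rewrite opprB subrKC => h2.
have := ler_wpM2l k0 h2; have := ler_wpM2l k0 (ltW sv); have := fk v; lra.
Qed.

Let graph_total s : exists w, graph s w.
Proof.
have [v sv] := choice (fun n => j_dense s (ltr0Sn_inv R n)).
have fB x y : f x - f y = f (x - y).
  by rewrite addrC -scaleN1r -fP scaleN1r addrC.
have jB x y : j x - j y = j (x - y).
  by rewrite addrC -scaleN1r -jP scaleN1r addrC.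
have fv_small e : 0 < e -> exists N, forall m n, (N <= m)%N -> (N <= n)%N ->
    nW (f (v m) - f (v n)) < e.
  (* Two approximation errors, each multiplied by [k], must stay below [e]; [k + 1] avoids a
     division by zero. *)
  move=> e0; have k1 : 0 < 2 * (k + 1) by rewrite mulr_gt0 ?ltr0n ?(ltr_wpDl k0).
  have [N NP] := inv_nat_small (divr_gt0 e0 k1).
  exists N => m n Nm Nn; rewrite fB (le_lt_trans (fk _))// -jB.
  have := is_norm_dist nSP s (j (v m)) (j (v n)).
  rewrite (is_normBC nSP _ s) => h1; have := ler_wpM2l k0 h1.
  pose d := e / (2 * (k + 1)).
  have dE : d * (2 * (k + 1)) = e by rewrite divfK// gt_eqF.
  have d0 : 0 < d by rewrite divr_gt0.
  have /ltW/(ler_wpM2l k0) := lt_trans (sv m) (NP _ Nm).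
  have /ltW/(ler_wpM2l k0) := lt_trans (sv n) (NP _ Nn).
  rewrite -/d; clearbody d; lra.
have [w wP] := nW_complete fv_small.
exists w => e e0.
have [N NP] := inv_nat_small e0; have [M MP] := wP _ e0.
exists (v (maxn N M)); split.
  by rewrite (lt_trans (sv _))// NP// leq_maxl.
by rewrite (is_normBC nWP) MP// leq_maxr.
Qed.

Lemma dense_extension : exists2 F : {linear S -> W},
  forall v, F (j v) = f v & forall s, nW (F s) <= k * nS s.
Proof.
have [F FP] := choice graph_total.
have graph_uniq s w w' : graph s w -> graph s w' -> w = w'.
  move=> sw sw'; apply/eqP; rewrite -subr_eq0; apply/eqP.
  case: nWP => _ _; apply; apply/eqP; rewrite eq_le is_norm_ge0// andbT.
  (* The difference of the two values lies over s - s = 0, so its norm is at most k * 0. *)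
  have := graph_bound (graph_linear (-1) sw' sw).
  by rewrite !scaleN1r addNr (is_norm0 nSP) mulr0 addrC.
have Flin : linear F.
  by move=> c s s'; apply: graph_uniq (FP _) _; apply: graph_linear.
exists (mk_linear Flin) => [v|s]; last exact: graph_bound.
apply: graph_uniq (FP _) _ => e e0; exists v.
by rewrite !subrr is_norm0// is_norm0.
Qed.

End DenseExtension.

(** * Hilbert spaces and cyclic subrepresentations *)

Section HilbertOf.
Variables (R : realType) (W : lmodType R[i]) (g : {dot W for (@Num.conj R[i])}).
Hypothesis g_complete : is_complete (dnorm g).

(** An alias of [W] that carries the completeness proof as a parameter, so that a Hilbert structure
    can be declared on it while [W] keeps its own structures. *)
Definition hilbert_of of is_complete (dnorm g) : Type := W.
Local Notation H := (hilbert_of g_complete).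

HB.instance Definition _ := GRing.Lmodule.on H.

Let norm (x : H) : R[i] := (dnorm g x)%:C.

Let ler_normD (x y : H) : norm (x + y) <= norm x + norm y.
Proof. by rewrite -rmorphD lecR (is_normD (dnorm_is_norm g)). Qed.

Let normrZ (c : R[i]) (x : H) : norm (c *: x) = `|c| * norm x.
Proof. by rewrite /norm (is_normZ (dnorm_is_norm g)) rmorphM/= cabsE. Qed.

Let normr0_eq0 (x : H) : norm x = 0 -> x = 0.
Proof. by case: (dnorm_is_norm g) => _ _ n0 /complexI/n0. Qed.

HB.instance Definition _ :=
  Lmodule_isNormed.Build R[i] H ler_normD normrZ normr0_eq0.

(** Completeness is asked for filters but given for sequences. A Cauchy filter contains a ball of
    radius 1/(n+1) for each n; any two of these balls meet, so their centres form a Cauchy sequence,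
    and its limit is a limit of the filter. *)
Let cvg_complete (F : set_system H) : ProperFilter F -> cauchy F -> cvg F.
Proof.
move=> FF /cauchyP F_cauchy.
have nP := dnorm_is_norm g.
have ballE (x : H) (r : R) : ball x r%:C = [set y : H | dnorm g (x - y) < r].
  by rewrite -ball_normE; apply/seteqP; split=> y; rewrite /ball_/= ltcR.
have /choice[x Fx] n : exists x : H, F [set y : H | dnorm g (x - y) < n.+1%:R^-1].
  have [|x] := F_cauchy (n.+1%:R^-1)%:C; first by rewrite ltcR ltr0Sn_inv.
  by rewrite ballE; exists x.
have x_cauchy (e : R) : 0 < e -> exists N, forall m n, (N <= m)%N -> (N <= n)%N ->
    dnorm g (x m - x n) < e.
  move=> e0; have e2 : 0 < e / 2 by rewrite divr_gt0.
  have [N NP] := inv_nat_small e2.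
  exists N => m n Nm Nn; have [y [/= ym yn]] := filter_ex (filterI (Fx m) (Fx n)).
  apply: le_lt_trans (is_norm_dist nP y _ _) _.
  rewrite (is_normBC nP y) [e]splitr ltrD//.
    exact: lt_trans ym (NP _ Nm).
  exact: lt_trans yn (NP _ Nn).
have [y yP] := g_complete x_cauchy.
apply/cvg_ex; exists y; apply/cvg_ballP => eps eps0.
have eps_real : (complex.Re eps)%:C = eps by rewrite Re_ge0K// ltW.
rewrite -eps_real ballE; rewrite -eps_real ltcR in eps0.
have e2 : 0 < complex.Re eps / 2 by rewrite divr_gt0.
have [N NP] := inv_nat_small e2; have [M MP] := yP _ e2.
apply: filterS (Fx (maxn N M)) => z /= xz.
apply: le_lt_trans (is_norm_dist nP (x (maxn N M)) _ _) _.
rewrite (is_normBC nP) [ltRHS]splitr ltrD ?MP ?leq_maxr//.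
by rewrite (lt_trans xz)// NP// leq_maxl.
Qed.

HB.instance Definition _ := Uniform_isComplete.Build H cvg_complete.

Definition hilbert_of_dot (x y : H) : R[i] := g x y.

Let zmodl (y : H) : zmod_morphism (hilbert_of_dot^~ y).
Proof. by move=> x x'; rewrite /hilbert_of_dot dotDl dotNl. Qed.

Let zmodr (x : H) : zmod_morphism (hilbert_of_dot x).
Proof. by move=> y y'; rewrite /hilbert_of_dot dotDr dotNr. Qed.

Let scall (y : H) : scalable_for *%R (hilbert_of_dot^~ y).
Proof. by move=> c x; rewrite /hilbert_of_dot dotZl. Qed.

Let scalr (x : H) : scalable_for (@Num.conj R[i] \; *%R) (hilbert_of_dot x).
Proof. by move=> c y; rewrite /hilbert_of_dot dotZr. Qed.

HB.instance Definition _ :=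
  isBilinear.Build R[i] H H R[i] *%R (@Num.conj R[i] \; *%R) hilbert_of_dot
    zmodl zmodr scall scalr.

Let herm (x y : H) :
  hilbert_of_dot x y = (-1) ^+ false * Num.conj (hilbert_of_dot y x).
Proof. by rewrite mul1r [LHS]dotC. Qed.

HB.instance Definition _ :=
  isHermitianSesquilinear.Build R[i] H false (@Num.conj R[i]) hilbert_of_dot herm.

Let pos (x : H) : x != 0 -> 0 < hilbert_of_dot x x.
Proof. by move=> x0; rewrite /hilbert_of_dot dnorm_gt0. Qed.

HB.instance Definition _ := isDotProduct.Build R[i] H hilbert_of_dot pos.

Let norm_inner (v : H) : `|v| ^+ 2 = hilbert_of_dot v v.
Proof. by rewrite /hilbert_of_dot -dnormE rmorphXn. Qed.

HB.instance Definition _ := isHilbert.Build R H norm_inner.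

End HilbertOf.

Section HilbertNorm.
Variables (R : realType) (H : hilbertType R).

Definition hnorm (v : H) : R := dnorm (@inner R H) v.

Lemma hnorm_is_norm : is_norm hnorm. Proof. exact: dnorm_is_norm. Qed.

Lemma hnormE (v : H) : (hnorm v)%:C = `|v|.
Proof.
apply/eqP; rewrite -(@eqrXn2 _ 2)// ?ler0c ?sqrtr_ge0//.
by rewrite -rmorphXn/= /hnorm dnormE norm_inner.
Qed.

Lemma hnorm_Re (v : H) : hnorm v = complex.Re `|v|.
Proof. by rewrite -hnormE. Qed.

Lemma hnorm_complete : is_complete hnorm.
Proof.
move=> x x_cauchy.
have [y xy] : exists y : H, (x @ \oo) --> y.
  apply/cvg_ex; apply: cauchy_cvg; apply: cauchy_exP => eps eps0.
  have [N NP] := x_cauchy _ (Re_gt0 eps0).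
  exists (x N), N => // n /= Nn; rewrite -ball_normE /ball_/= -hnormE.
  by rewrite -(Re_ge0K (ltW eps0)) ltcR NP.
exists y => e e0; have ec0 : 0 < e%:C by rewrite ltcR.
move/cvgrPdist_lt: xy => /(_ _ ec0)[N _ NP].
exists N => n /NP; rewrite /= distrC -hnormE ltcR; exact.
Qed.

Lemma linear_bounded_continuousP (f : {linear H -> H}) :
  continuous f <-> exists2 k, 0 <= k & forall v, hnorm (f v) <= k * hnorm v.
Proof.
split=> [/linear_bounded_continuous/linear_boundedP/pinfty_ex_gt0|[k k0 fk]].
  move=> [r r0 fr]; exists (complex.Re r) => [|v]; first by rewrite ltW ?Re_gt0.
  by have := fr v; rewrite -!hnormE -{1}(Re_ge0K (ltW r0)) -rmorphM lecR.
apply/linear_bounded_continuous/linear_boundedP; near=> r => v.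
have kr : k%:C <= r by near: r; apply: nbhs_pinfty_ge; rewrite ger0_real ?ler0c.
apply: le_trans (ler_wpM2r _ kr); last by [].
by rewrite -!hnormE -rmorphM lecR.
Unshelve. all: by end_near. Qed.

Lemma dense_hnormP (A : set H) :
  dense A <-> forall v (e : R), 0 < e -> exists2 a, A a & hnorm (v - a) < e.
Proof.
split=> [A_dense v e e0|A_dense O [v Ov] O_open].
  have ec0 : 0 < e%:C by rewrite ltcR.
  have [|a [va Aa]] := A_dense (ball v e%:C) _ (ball_open _ _).
    by exists v; exact: ballxx.
  by exists a => //; move: va; rewrite -ball_normE /ball_/= -hnormE ltcR.
have /nbhs_ballP[eps eps0 vO] : nbhs v O by apply: open_nbhs_nbhs.
have [a Aa va] := A_dense v _ (Re_gt0 eps0).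
exists a; split=> //; apply: vO.
by rewrite -ball_normE /ball_/= -hnormE -(Re_ge0K (ltW eps0)) ltcR.
Qed.

End HilbertNorm.

Section ClosedSubspace.
Variables (R : realType) (W : lmodType R[i]) (g : {dot W for (@Num.conj R[i])}).
Variables (V : lmodType R[i]) (j : {linear V -> W}).

Let gP := dnorm_is_norm g.

(** The closure of the range of [j], made boolean by classical logic because the submodule and
    subtype structures require a predicate with values in [bool]. *)
Definition closed_span : pred W :=
  fun w => `[< forall e : R, 0 < e -> exists v, dnorm g (w - j v) < e >].

Lemma closed_spanP w : reflect
  (forall e : R, 0 < e -> exists v, dnorm g (w - j v) < e) (w \in closed_span).
Proof. exact: asboolP. Qed.

Lemma closed_span_submod : GRing.submod_closed closed_span.
Proof.
split=> [|c x y /closed_spanP xP /closed_spanP yP].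
  by apply/closed_spanP => e e0; exists 0; rewrite linear0 subrr is_norm0.
apply/closed_spanP => e e0.
have c0 : 0 < cabs c + 1 := ltr_wpDl (cabs_ge0 c) ltr01.
pose d := e / (cabs c + 1); have d0 : 0 < d by rewrite divr_gt0.
have dE : d * (cabs c + 1) = e by rewrite divfK// gt_eqF.
have [v xv] := xP _ d0; have [v' yv'] := yP _ d0; clearbody d.
exists (c *: v + v'); rewrite linearP opprD addrACA -scalerBr.
have := is_normD gP (c *: (x - j v)) (y - j v'); rewrite is_normZ//.
have := ler_wpM2l (cabs_ge0 c) (ltW xv); lra.
Qed.

HB.instance Definition _ :=
  GRing.isSubmodClosed.Build R[i] W closed_span closed_span_submod.

Definition closure_of : Type := {w : W | w \in closed_span}.

HB.instance Definition _ := SubChoice.on closure_of.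
HB.instance Definition _ := [SubChoice_isSubLmodule of closure_of by <:].

Definition closure_dot (x y : closure_of) : R[i] := g (val x) (val y).

Let zmodl y : zmod_morphism (closure_dot^~ y).
Proof. by move=> x x'; rewrite /closure_dot raddfB dotDl dotNl. Qed.

Let zmodr x : zmod_morphism (closure_dot x).
Proof. by move=> y y'; rewrite /closure_dot raddfB. Qed.

Let scall y : scalable_for *%R (closure_dot^~ y).
Proof. by move=> c x; rewrite /closure_dot linearZ dotZl. Qed.

Let scalr x : scalable_for (@Num.conj R[i] \; *%R) (closure_dot x).
Proof. by move=> c y; rewrite /closure_dot linearZ. Qed.

HB.instance Definition _ :=
  isBilinear.Build R[i] closure_of closure_of R[i] *%R (@Num.conj R[i] \; *%R)
    closure_dot zmodl zmodr scall scalr.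

Let herm x y : closure_dot x y = (-1) ^+ false * Num.conj (closure_dot y x).
Proof. by rewrite mul1r [LHS]dotC. Qed.

HB.instance Definition _ := isHermitianSesquilinear.Build R[i] closure_of false
  (@Num.conj R[i]) closure_dot herm.

Let pos x : x != 0 -> 0 < closure_dot x x.
Proof. by move=> x0; rewrite /closure_dot dnorm_gt0 -val_eqE in x0 *. Qed.

HB.instance Definition _ := isDotProduct.Build R[i] closure_of closure_dot pos.

Lemma closure_complete : is_complete (dnorm g) -> is_complete (dnorm closure_dot).
Proof.
move=> gc x x_cauchy.
have [|w wP] := gc (val \o x).
  move=> e /x_cauchy[N NP]; exists N => m n Nm Nn.
  exact: (NP m n Nm Nn).
have wS : w \in closed_span.
  apply/closed_spanP => e e0; have e2 : 0 < e / 2 by rewrite divr_gt0.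
  have [N NP] := wP _ e2.
  have /closed_spanP/(_ _ e2)[v xv] := valP (x N).
  exists v; apply: le_lt_trans (is_norm_dist gP (val (x N)) _ _) _.
  by rewrite [e]splitr ltrD// (is_normBC gP) NP.
exists (exist _ w wS) => e /wP[N NP]; exists N => n /NP.
by rewrite /dnorm /= /closure_dot raddfB.
Qed.

End ClosedSubspace.

(** The analogue of [is_representation] over a bare inner product, with boundedness in place of
    continuity. Direct sums and composites can thus be formed before any Hilbert structure is
    built. *)
Definition is_dot_representation (R : realType) (A : starAlgType R)
    (W : lmodType R[i]) (g : {dot W for (@Num.conj R[i])})
    (s : A -> W -> W) :=
  [/\ forall a, exists2 k, 0 <= k & forall w, dnorm g (s a w) <= k * dnorm g w,
      forall a, linear (s a),
      forall c a b w, s (c *: a + b) w = c *: s a w + s b w,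
      forall a b w, s (a * b) w = s a (s b w) &
      (forall w, s 1 w = w) /\
      forall a v w, g (s (star a) v) w = g v (s a w)].

Lemma is_dot_representationP (R : realType) (A : starAlgType R)
    (H : hilbertType R) (pi : A -> {linear H -> H}) :
  is_representation pi <->
  is_dot_representation (@inner R H) (fun a v => pi a v).
Proof.
split=> [[pic pil piM pi1 piS]|[pib _ pil piM [pi1 piS]]]; split=> //.
- by move=> a; exact/linear_bounded_continuousP.
- by move=> a c v w; rewrite linearP.
- by move=> a; apply/linear_bounded_continuousP/pib.
Qed.

Section CyclicSubrepresentation.
Variables (R : realType) (A : starAlgType R) (W : lmodType R[i]).
Variables (g : {dot W for (@Num.conj R[i])}) (s : A -> W -> W) (z : W).
Hypothesis g_complete : is_complete (dnorm g).
Hypothesis sP : is_dot_representation g s.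

Let orbit_linear : linear (fun a => s a z).
Proof. by case: sP => _ _ sl _ _ c a b; exact: sl. Qed.

Let j := mk_linear orbit_linear.

Let cl := closure_of g j.

(** The orbit of [z] is invariant by multiplicativity, and its closure is invariant because [s a] is
    bounded. *)
Let s_closed a (w : cl) : s a (val w) \in closed_span g j.
Proof.
case: sP => sb sl _ sM _; apply/closed_spanP => e e0.
have [k k0 sk] := sb a.
have k1 : 0 < k + 1 := ltr_wpDl k0 ltr01.
have /closed_spanP/(_ _ (divr_gt0 e0 k1))[b wb] := valP w.
exists (a * b); rewrite /j/= sM -[X in _ - X]scale1r.
rewrite -scaleNr addrC -sl scaleN1r addrC.
move: wb; rewrite ltr_pdivlMr// => wb; apply: le_lt_trans (sk _) _.
have := is_norm_ge0 (dnorm_is_norm g) (val w - j b); move: wb.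
rewrite /j /=; nra.
Qed.

Let H := hilbert_of (closure_complete (j := j) g_complete).

Let rep a (x : H) : H := exist (fun w => w \in closed_span g j) _ (s_closed a x).

Let rep_linear a : linear (rep a).
Proof.
by case: sP => _ sl _ _ _ c x y; apply: val_inj; exact: sl.
Qed.

Let pi a : {linear H -> H} := mk_linear (rep_linear a).

Let cyclic_closed : z \in closed_span g j.
Proof.
case: sP => _ _ _ _ [s1 _]; apply/closed_spanP => e e0; exists 1.
by rewrite /j /= s1 subrr is_norm0//; exact: dnorm_is_norm.
Qed.

Let xi : H := exist (fun w => w \in closed_span g j) _ cyclic_closed.

(** The space is the closure of the orbit of [z], which contains z = s 1 z. It is presented through
    an isometric embedding [i], which hides the subtype. It yields the GNS triple in one comparison
    of norms and the two tensor factors in the other. *)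
Lemma cyclic_subrepresentation :
  exists (H : hilbertType R) (i : {linear H -> W}) (pi : A -> {linear H -> H})
    (xi : H),
  [/\ is_representation pi, dense (range (fun a => pi a xi)),
      forall x y, '[x, y] = g (i x) (i y), i xi = z &
      forall a x, i (pi a x) = s a (i x)].
Proof.
case: sP => sb sl sl' sM [s1 sS].
have val_lin : linear (fun x : H => val (x : cl)) by [].
exists H, (mk_linear val_lin), pi, xi; split=> //.
  apply/is_dot_representationP; split.
  - move=> a; have [k k0 sk] := sb a; exists k => // x.
    exact: (sk (val (x : cl))).
  - by move=> a c x y; exact: rep_linear.
  - by move=> c a b x; apply: val_inj; exact: sl'.
  - by move=> a b x; apply: val_inj; exact: sM.
  - by split=> [x|a x y]; [apply: val_inj; exact: s1 | exact: sS].
apply/dense_hnormP => x e e0.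
have /closed_spanP/(_ _ e0)[a xa] := valP (x : cl).
by exists (pi a xi); first by exists a.
Qed.

End CyclicSubrepresentation.

Section DotSum.
Variables (R : realType) (H : hilbertType R).
Local Notation K := (H * H)%type.

Definition sum_dot (x y : K) : R[i] := '[x.1, y.1] + '[x.2, y.2].

Let zmodl y : zmod_morphism (sum_dot^~ y).
Proof.
by move=> x x'; rewrite /sum_dot !dotDl !dotNl opprD addrACA.
Qed.

Let zmodr x : zmod_morphism (sum_dot x).
Proof.
by move=> y y'; rewrite /sum_dot !dotDr !dotNr opprD addrACA.
Qed.

Let scall y : scalable_for *%R (sum_dot^~ y).
Proof. by move=> c x; rewrite /sum_dot !dotZl mulrDr. Qed.

Let scalr x : scalable_for (@Num.conj R[i] \; *%R) (sum_dot x).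
Proof. by move=> c y; rewrite /sum_dot !dotZr -mulrDr. Qed.

HB.instance Definition _ :=
  isBilinear.Build R[i] K K R[i] *%R (@Num.conj R[i] \; *%R) sum_dot
    zmodl zmodr scall scalr.

Let herm x y : sum_dot x y = (-1) ^+ false * Num.conj (sum_dot y x).
Proof.
by rewrite mul1r /sum_dot (dotC _ x.1) (dotC _ x.2) -rmorphD.
Qed.

HB.instance Definition _ := isHermitianSesquilinear.Build R[i] K false
  (@Num.conj R[i]) sum_dot herm.

Let pos x : x != 0 -> 0 < sum_dot x x.
Proof.
case: x => x y; rewrite xpair_eqE negb_and /sum_dot => /orP[]/= h.
  by rewrite ltr_pwDl ?dnorm_gt0 ?dot_ge0.
by rewrite ltr_wpDl ?dnorm_gt0 ?dot_ge0.
Qed.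

HB.instance Definition _ := isDotProduct.Build R[i] K sum_dot pos.

Lemma sum_dnormE (x : K) :
  dnorm sum_dot x ^+ 2 = hnorm x.1 ^+ 2 + hnorm x.2 ^+ 2.
Proof. by rewrite !dnormE_Re -ReD. Qed.

Lemma sum_dnorm_ge (x : K) :
  hnorm x.1 <= dnorm sum_dot x /\ hnorm x.2 <= dnorm sum_dot x.
Proof.
by split; rewrite -(@ler_pXn2r _ 2)// ?nnegrE ?sqrtr_ge0// sum_dnormE
  (lerDl, lerDr) sqr_ge0.
Qed.

Lemma sum_dnorm_le (x : K) : dnorm sum_dot x <= hnorm x.1 + hnorm x.2.
Proof.
have [h1 h2] : 0 <= hnorm x.1 /\ 0 <= hnorm x.2 by split; exact: sqrtr_ge0.
rewrite -(@ler_pXn2r _ 2)// ?nnegrE ?addr_ge0 ?sqrtr_ge0//.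
by rewrite sum_dnormE; nra.
Qed.

Lemma sum_dot_complete : is_complete (dnorm sum_dot).
Proof.
move=> x x_cauchy.
have [e|y1 yP1] := @hnorm_complete R H (fst \o x).
  move=> /x_cauchy[N NP]; exists N => m n Nm Nn.
  by apply: le_lt_trans (NP _ _ Nm Nn); case: (sum_dnorm_ge (x m - x n)).
have [e|y2 yP2] := @hnorm_complete R H (snd \o x).
  move=> /x_cauchy[N NP]; exists N => m n Nm Nn.
  by apply: le_lt_trans (NP _ _ Nm Nn); case: (sum_dnorm_ge (x m - x n)).
exists (y1, y2) => e e0; have e2 : 0 < e / 2 by rewrite divr_gt0.
have [N NP] := yP1 _ e2; have [M MP] := yP2 _ e2.
exists (maxn N M) => n; rewrite geq_max => /andP[/NP nN /MP nM].
by rewrite (le_lt_trans (sum_dnorm_le _))// [e]splitr ltrD.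
Qed.

Lemma sum_dot_representation (A : starAlgType R) (s s' : A -> H -> H) :
  is_dot_representation (@inner R H) s -> is_dot_representation (@inner R H) s' ->
  is_dot_representation sum_dot (fun a x => (s a x.1, s' a x.2)).
Proof.
move=> [sb sl sl' sM [s1 sS]] [tb tl tl' tM [t1 tS]]; split.
- move=> a; have [k k0 sk] := sb a; have [k' k'0 tk] := tb a.
  exists (k + k') => [|x]; first by rewrite addr_ge0.
  apply: le_trans (sum_dnorm_le _) _ => /=.
  have [] := sum_dnorm_ge x; have := sk x.1; have := tk x.2.
  rewrite -/(hnorm _); set d := dnorm sum_dot x => h1 h2 h3 h4.
  have := ler_wpM2l k0 h3; have := ler_wpM2l k'0 h4.
  rewrite /hnorm in h1 h2 *; lra.
- by move=> a c x y /=; rewrite sl tl.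
- by move=> c a b x; rewrite sl' tl'.
- by move=> a b x /=; rewrite sM tM.
- split=> [[x y]|a x y]; first by rewrite /= s1 t1.
  exact: (f_equal2 (fun c d : R[i] => c + d) (sS a x.1 y.1) (tS a x.2 y.2)).
Qed.

End DotSum.

(** * A growth estimate that removes constants *)

Section PowerTrick.
Variable R : realType.

Lemma bernoulli_ineq (t : R) (n : nat) : 1 <= t -> 1 + n%:R * (t - 1) <= t ^+ n.
Proof.
move=> t1; elim: n => [|n IH]; first by rewrite mul0r addr0 expr0.
rewrite exprS -natr1; have : 0 <= n%:R :> R by rewrite ler0n.
move=> n0; have := mulr_ge0 n0 (sqr_ge0 (t - 1)).
have := ler_wpM2l (le_trans ler01 t1) IH; rewrite expr2; lra.
Qed.

(** Put r = a 0 / s. Repeated squaring gives r^(2^n) <= a n / s, hence (r/q)^(2^n) <= k/s for every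
    n. If r exceeded q, the left side would be unbounded by the Bernoulli inequality. *)
Lemma power_trick (a : nat -> R) (s k q : R) : 0 <= s -> 0 <= q ->
  (forall n, 0 <= a n) -> (forall n, a n ^+ 2 <= a n.+1 * s) ->
  (forall n, a n <= k * q ^+ (2 ^ n)) -> a 0 <= q * s.
Proof.
move=> s0 q0 a0 as_ aq; rewrite leNgt; apply/negP => qa.
have a0_gt0 : 0 < a 0 by rewrite (le_lt_trans _ qa)// mulr_ge0.
have s_gt0 : 0 < s.
  rewrite lt_neqAle s0 andbT eq_sym; apply/eqP => sE.
  by have := as_ 0; rewrite sE mulr0 leNgt exprn_gt0.
have q_gt0 : 0 < q.
  rewrite lt_neqAle q0 andbT eq_sym; apply/eqP => qE.
  by have := aq 0; rewrite qE expn0 expr1 mulr0 leNgt a0_gt0.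
pose r := a 0 / s; pose t := r / q.
have t1 : 1 < t by rewrite ltr_pdivlMr// mul1r ltr_pdivlMr.
have ra n : r ^+ (2 ^ n) <= a n / s.
  elim: n => [|n IH]; first by rewrite expn0 expr1.
  have r0 : 0 <= r ^+ (2 ^ n) by rewrite exprn_ge0// divr_ge0.
  rewrite expnS mulnC exprM; apply: (@le_trans _ _ ((a n / s) ^+ 2)).
    by rewrite ler_pXn2r// nnegrE divr_ge0.
  by rewrite expr_div_n ler_pdivrMr ?exprn_gt0// mulrA divfK ?gt_eqF ?as_.
have tk n : t ^+ (2 ^ n) <= k / s.
  rewrite expr_div_n ler_pdivrMr ?exprn_gt0//.
  by rewrite mulrAC (le_trans (ra n))// ler_pM2r ?invr_gt0.
have t0 : 0 < t - 1 by rewrite subr_gt0.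
(* For this [n], k/s < (n+1)(t-1) <= 2^n (t-1) < t^(2^n), against [tk]. *)
have := tk (Num.truncn (k / s / (t - 1))).
set n := Num.truncn _; have := truncnS_gt (k / s / (t - 1)); rewrite -/n.
rewrite ltr_pdivrMr// => kn tn.
have := bernoulli_ineq (2 ^ n) (ltW t1).
have : n.+1%:R <= (2 ^ n)%:R :> R by rewrite ler_nat ltn_expl.
nra.
Qed.

End PowerTrick.

(** * Graded algebras and the algebraic isomorphism *)

Lemma starN (R : realType) (T : starAlgType R) (a : T) : star (- a) = - star a.
Proof. by rewrite -scaleN1r starZ rmorphN1 scaleN1r. Qed.

Section Parity.
Variables (R : realType) (A : gradedCStarAlgType R).
Implicit Types a b : A.

Lemma gradingD a b : grading (a + b) = grading a + grading b.
Proof. by have := grading_linear 1 a b; rewrite !scale1r. Qed.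

Lemma grading0 : grading 0 = 0 :> A.
Proof. by apply: (addrI (grading 0)); rewrite -gradingD !addr0. Qed.

Lemma gradingZ (c : R[i]) a : grading (c *: a) = c *: grading a.
Proof. by have := grading_linear c a 0; rewrite addr0 grading0 addr0. Qed.

Lemma gradingN a : grading (- a) = - grading a.
Proof. by rewrite -scaleN1r gradingZ scaleN1r. Qed.

Lemma grading1 : grading 1 = 1 :> A.
Proof.
by rewrite -[LHS]mulr1 -{2}[1](gradingK 1) -gradingM mul1r gradingK.
Qed.

Definition even_part a := 2^-1 *: (a + grading a).
Definition odd_part a := 2^-1 *: (a - grading a).

Lemma even_part_linear : linear even_part.
Proof.
move=> c a b; rewrite /even_part grading_linear scalerA mulrC -scalerA -scalerDr.
by rewrite [c *: (_ + _)]scalerDr addrACA.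
Qed.

Lemma odd_part_linear : linear odd_part.
Proof.
move=> c a b; rewrite /odd_part grading_linear scalerA mulrC -scalerA -scalerDr.
by rewrite [c *: (_ - _)]scalerBr opprD addrACA.
Qed.

Lemma evenP a : reflect (grading a = a) (even a). Proof. exact: eqP. Qed.
Lemma oddP a : reflect (grading a = - a) (odd a). Proof. exact: eqP. Qed.

Lemma half_add (V : lmodType R[i]) (v : V) : 2^-1 *: (v + v) = v.
Proof. by rewrite -mulr2n -[v *+ 2]scaler_nat scalerA mulVf ?scale1r ?pnatr_eq0. Qed.

Lemma even_part_id a : even a -> even_part a = a.
Proof. by move=> /evenP aE; rewrite /even_part aE half_add. Qed.

Lemma even_part_odd a : odd a -> even_part a = 0.
Proof. by move=> /oddP aE; rewrite /even_part aE subrr scaler0. Qed.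

Lemma odd_part_id a : odd a -> odd_part a = a.
Proof. by move=> /oddP aE; rewrite /odd_part aE opprK half_add. Qed.

Lemma odd_part_even a : even a -> odd_part a = 0.
Proof. by move=> /evenP aE; rewrite /odd_part aE subrr scaler0. Qed.

Lemma even_partP a : even (even_part a).
Proof. by apply/evenP; rewrite gradingZ gradingD gradingK addrC. Qed.

Lemma odd_partP a : odd (odd_part a).
Proof.
by apply/oddP; rewrite gradingZ gradingD gradingN gradingK -scalerN opprB addrC.
Qed.

Lemma parts_add a : even_part a + odd_part a = a.
Proof. by rewrite -scalerDr addrACA subrr addr0 half_add. Qed.

Lemma even_homogeneous a : even a -> homogeneous a.
Proof. by rewrite /homogeneous => ->. Qed.

Lemma odd_homogeneous a : odd a -> homogeneous a.
Proof. by rewrite /homogeneous => ->; rewrite orbT. Qed.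

Lemma even1 : even (1 : A). Proof. by apply/evenP; exact: grading1. Qed.

Lemma even_odd0 a : even a -> odd a -> a = 0.
Proof. by move=> aE aO; rewrite -(even_part_id aE) even_part_odd. Qed.

Lemma odd1F : odd (1 : A) = false.
Proof.
apply/negP => /(even_odd0 even1)/eqP; apply/negP; exact: oner_neq0.
Qed.

Lemma mul_even_even a b : even a -> even b -> even (a * b).
Proof. by move=> /evenP aE /evenP bE; apply/evenP; rewrite gradingM aE bE. Qed.

Lemma mul_odd_odd a b : odd a -> odd b -> even (a * b).
Proof. by move=> /oddP aE /oddP bE; apply/evenP; rewrite gradingM aE bE mulrNN. Qed.

Lemma mul_even_odd a b : even a -> odd b -> odd (a * b).
Proof. by move=> /evenP aE /oddP bE; apply/oddP; rewrite gradingM aE bE mulrN. Qed.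

Lemma mul_odd_even a b : odd a -> even b -> odd (a * b).
Proof. by move=> /oddP aE /evenP bE; apply/oddP; rewrite gradingM aE bE mulNr. Qed.

Lemma even_grading a : even a -> even (grading a).
Proof. by move=> /evenP aE; apply/evenP; rewrite !aE. Qed.

Lemma odd_grading a : odd a -> odd (grading a).
Proof. by move=> /oddP aE; apply/oddP; rewrite aE gradingN aE. Qed.

Lemma even_star a : even a -> even (star a).
Proof. by move=> /evenP aE; apply/evenP; rewrite grading_star aE. Qed.

Lemma odd_star a : odd a -> odd (star a).
Proof. by move=> /oddP aE; apply/oddP; rewrite grading_star aE starN. Qed.

Variable u : A.
Hypothesis uP : inner_grading u.

Lemma inner_gradingK : u * u = 1.
Proof. by case: uP => su <- _ _; rewrite su. Qed.

Lemma inner_grading_comm a : u * a = grading a * u.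
Proof. by case: uP => su _ su1 ->; rewrite -mulrA su1 mulr1. Qed.

Lemma inner_grading_even : even u.
Proof. by case: uP => su us _ uE; apply/evenP; rewrite uE -mulrA us mulr1. Qed.

Lemma inner_grading_star : star u = u. Proof. by case: uP. Qed.

End Parity.

Section AlgebraicTensor.
Variables (R : realType) (A B : gradedCStarAlgType R) (T : lmodType R[i]).
Variable tau : {bilinear A -> B -> T}.
Hypothesis tauP : is_algebraic_tensor tau.

(** Splitting both factors into even and odd parts shows that homogeneous pure tensors span, so
    identities need only be checked where the Fermi sign rule is available. *)
Lemma tensor_ind (P : T -> Prop) :
  (forall x y, P x -> P y -> P (x + y)) ->
  (forall a b, homogeneous a -> homogeneous b -> P (tau a b)) ->
  forall x, P x.
Proof.
move=> PD Pt x; have P0 : P 0.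
  (* The empty sum is reached as the pure tensor of two zeros, which are homogeneous. *)
  rewrite -(linear0l tau 0).
  by apply: Pt; apply/even_homogeneous/evenP; exact: grading0.
have Pt' a b : P (tau a b).
  rewrite -(parts_add a) -(parts_add b) !linearDl !linearDr.
  apply: (PD); apply: (PD); apply: Pt;
    by [apply/even_homogeneous/even_partP | apply/odd_homogeneous/odd_partP].
have [s ->] := tauP.1 x.
by elim/big_ind: _ => //= p _; exact: Pt'.
Qed.

Lemma tensor_morph (W : lmodType R[i]) (f : A -> B -> W) :
  (forall b, linear (f^~ b)) -> (forall a, linear (f a)) ->
  exists g : {linear T -> W}, forall a b, g (tau a b) = f a b.
Proof.
move=> fl fr.
pose F : {bilinear A -> B -> W} :=
  HB.pack f (bilinear_isBilinear.Build R[i] A B W *:%R *:%R f (fl, fr)).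
by have [g gP] := tauP.2 _ F; exists g.
Qed.

End AlgebraicTensor.

(** Stated for plain functions, so that it applies to gradings and to maps such as a |-> a (x) 1
    without packing them as morphisms. *)
Definition is_star_hom (R : realType) (S T : starAlgType R) (f : S -> T) :=
  [/\ linear f, {morph f : x y / x * y}, f 1 = 1 &
      forall x, f (star x) = star (f x)].

Lemma star_hom_representation (R : realType) (S T : starAlgType R) (f : S -> T)
    (W : lmodType R[i]) (g : {dot W for (@Num.conj R[i])}) (s : T -> W -> W) :
  is_star_hom f -> is_dot_representation g s ->
  is_dot_representation g (s \o f).
Proof.
move=> [fl fM f1 fS] [sb sl sl' sM [s1 sS]]; split => /=.
- by move=> a; exact: sb.
- by move=> a; exact: sl.
- by move=> c a b w; rewrite fl sl'.
- by move=> a b w; rewrite fM sM.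
- by split=> [w|a v w]; rewrite ?f1 ?s1 ?fS ?sS.
Qed.

(** * The twist between the Fermi and the usual algebraic tensor product *)

Section Twist.
Variables (R : realType) (A B : gradedCStarAlgType R).
Variables (F : fermiTensor A B) (X : minTensor A B) (u : A).
Hypothesis uP : inner_grading u.
Local Notation tF := (fermi_pure F).
Local Notation tX := (min_pure X).

(** The unit of a model is not given as a tensor; 1 (x) 1 is a left unit on homogeneous pure
    tensors, hence everywhere, and so equals it. *)
Lemma fermi_unit : tF 1 1 = 1.
Proof.
suff tF1 : forall x, tF 1 1 * x = x by rewrite -[LHS]mulr1 tF1.
apply: (tensor_ind (fermi_algP F)) => [x y xE yE|a b ha hb].
  by rewrite mulrDr xE yE.
rewrite fermi_mul//; do ?exact/even_homogeneous/even1.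
by rewrite !mul1r /eps odd1F scale1r.
Qed.

Lemma min_unit : tX 1 1 = 1.
Proof.
suff tX1 : forall x, tX 1 1 * x = x by rewrite -[LHS]mulr1 tX1.
apply: (tensor_ind (min_algP X)) => [x y xE yE|a b ha hb].
  by rewrite mulrDr xE yE.
by rewrite min_mul !mul1r.
Qed.

(** The map a (x) b |-> a u^|b| (x) b, extended linearly in [b]. As u^2 = 1, the same formula
    describes the isomorphism and its inverse. *)
Definition twisted (T : lmodType R[i]) (t : {bilinear A -> B -> T}) a b :=
  t a (even_part b) + t (a * u) (odd_part b).

Lemma twisted_even (T : lmodType R[i]) (t : {bilinear A -> B -> T}) a b :
  even b -> twisted t a b = t a b.
Proof.
by move=> bE; rewrite /twisted even_part_id// odd_part_even// linear0r addr0.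
Qed.

Lemma twisted_odd (T : lmodType R[i]) (t : {bilinear A -> B -> T}) a b :
  odd b -> twisted t a b = t (a * u) b.
Proof.
by move=> bO; rewrite /twisted odd_part_id// even_part_odd// linear0r add0r.
Qed.

Lemma twisted_linear (T : lmodType R[i]) (t : {bilinear A -> B -> T}) :
  (forall b, linear ((twisted t)^~ b)) /\ (forall a, linear (twisted t a)).
Proof.
split=> [b c a a'|a c b b']; rewrite /twisted.
  by rewrite mulrDl -scalerAl !linearDl !linearZl_LR/= scalerDr addrACA.
rewrite even_part_linear odd_part_linear !linearDr !linearZr_LR/=.
by rewrite scalerDr addrACA.
Qed.

Lemma homogeneousP (C : gradedCStarAlgType R) (c : C) :
  homogeneous c -> odd c \/ even c /\ odd c = false.
Proof. by rewrite /homogeneous; case: (odd c) => [|/orP[]//]; [left|right]. Qed.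

Lemma eps_even (a : A) (b : B) : odd b = false -> eps b a = 1.
Proof. by rewrite /eps => ->. Qed.

(** Moving [u] past [a] costs exactly the sign of moving an odd [b] past [a]; this is how the twist
    absorbs the Fermi sign. *)
Lemma eps_odd (a : A) (b : B) : odd b -> homogeneous a ->
  u * a = eps b a *: (a * u).
Proof.
move=> bO ah; rewrite inner_grading_comm// /eps bO/=.
have [aO|[/evenP -> ->]] := homogeneousP ah; last by rewrite scale1r.
by rewrite aO; move/oddP: aO => ->; rewrite scaleN1r mulNr.
Qed.

Lemma twist_star_hom (h : {linear fermi_alg F -> min_alg X}) :
  (forall a b, h (tF a b) = twisted tX a b) -> is_star_hom h.
Proof.
move=> hE.
have hM : {morph h : x y / x * y}.
  move=> x; move: x; apply: (tensor_ind (fermi_algP F)) => [x y xE yE z|a b ha hb].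
    by rewrite mulrDl !linearD xE yE mulrDl.
  apply: (tensor_ind (fermi_algP F)) => [x y xE yE|a' b' ha' hb'].
    by rewrite mulrDr !linearD xE yE mulrDr.
  rewrite fermi_mul// linearZ/= !hE.
  (* For odd [b], its [u] moves past a' and produces the Fermi sign; when b' is odd too, the two
     copies of [u] cancel. For even [b] there is no sign. *)
  have [bO|[bE bO]] := homogeneousP hb; have [b'O|[b'E b'O]] := homogeneousP hb'.
  - rewrite (twisted_even _ _ (mul_odd_odd bO b'O)) !twisted_odd// min_mul.
    rewrite -mulrA (mulrA u) (eps_odd bO ha') -scalerAl -(mulrA a') inner_gradingK//.
    by rewrite mulr1 -scalerAr linearZl_LR.
  - rewrite (twisted_odd _ _ (mul_odd_even bO b'E)) (twisted_even _ _ b'E).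
    rewrite twisted_odd// min_mul -(mulrA a u a') (eps_odd bO ha').
    by rewrite -scalerAr linearZl_LR mulrA.
  - rewrite eps_even// scale1r (twisted_odd _ _ (mul_even_odd bE b'O)).
    by rewrite twisted_even// twisted_odd// min_mul mulrA.
  - rewrite eps_even// scale1r (twisted_even _ _ (mul_even_even bE b'E)).
    by rewrite !twisted_even// min_mul.
split=> //.
- by move=> c x y; rewrite linearP.
- by rewrite -fermi_unit hE twisted_even ?even1// min_unit.
apply: (tensor_ind (fermi_algP F)) => [x y xE yE|a b ha hb].
  by rewrite starD !linearD xE yE starD.
rewrite fermi_star// linearZ/= !hE.
have [bO|[bE bO]] := homogeneousP hb.
  rewrite !twisted_odd ?odd_star// min_star starM (inner_grading_star uP).
  (* The involution turns a u into u a^*, and restoring the order costs the sign of [b] against a^*,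
     which has the parity of [a]. *)
  have epsC : eps a b = eps b (star a).
    rewrite /eps andbC; congr (if _ && _ then _ else _).
    by apply/idP/idP => /odd_star; rewrite ?starK.
  rewrite epsC (eps_odd bO) ?linearZl_LR//.
  by have [aO|[aE _]] := homogeneousP ha;
    [exact/odd_homogeneous/odd_star | exact/even_homogeneous/even_star].
by rewrite /eps bO andbF scale1r !twisted_even ?even_star// min_star.
Qed.

(** The twist does not change the second factor, so applying it twice multiplies the first one by
    u^2 = 1 or by nothing. The map [k] is a *-homomorphism as the inverse of one. *)
Lemma twist_isomorphism :
  exists (h : {linear fermi_alg F -> min_alg X})
         (k : {linear min_alg X -> fermi_alg F}),
  [/\ is_star_hom h /\ is_star_hom k, cancel h k, cancel k h,
      forall a b, h (tF a b) = twisted tX a b &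
      forall a b, k (tX a b) = twisted tF a b].
Proof.
have [hl hr] := twisted_linear tX; have [kl kr] := twisted_linear tF.
have [h hE] := tensor_morph (fermi_algP F) hl hr.
have [k kE] := tensor_morph (min_algP X) kl kr.
have hk : cancel h k.
  apply: (tensor_ind (fermi_algP F)) => [x y xE yE|a b ha hb].
    by rewrite !linearD xE yE.
  have [bO|[bE _]] := homogeneousP hb; rewrite hE.
    by rewrite twisted_odd// kE twisted_odd// -mulrA inner_gradingK// mulr1.
  by rewrite twisted_even// kE twisted_even.
have kh : cancel k h.
  apply: (tensor_ind (min_algP X)) => [x y xE yE|a b ha hb].
    by rewrite !linearD xE yE.
  have [bO|[bE _]] := homogeneousP hb; rewrite kE.
    by rewrite twisted_odd// hE twisted_odd// -mulrA inner_gradingK// mulr1.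
  by rewrite twisted_even// hE twisted_even.
have hP := twist_star_hom hE; exists h, k; split=> //; split=> //.
case: hP => _ hM h1 hS; split.
- by move=> c x y; rewrite linearP.
- by move=> x y; apply: (can_inj hk); rewrite hM !kh.
- by rewrite -h1 hk.
- by move=> x; apply: (can_inj hk); rewrite hS !kh.
Qed.

(** This is id (x) beta; composed with a representation it gives the second copy in the doubling
    argument for [bounded_unit]. *)
Lemma grading_tensor_star_hom :
  exists2 h : {linear min_alg X -> min_alg X}, is_star_hom h &
    forall a b, h (tX a b) = tX a (grading b).
Proof.
have [|a c b b'|h hE] := @tensor_morph R A B _ _ (min_algP X) _
    (fun a b => tX a (grading b)).
- by move=> b c a a'; rewrite linearDl linearZl_LR.
- by rewrite grading_linear linearDr linearZr_LR.
exists h => //; split.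
- by move=> c x y; rewrite linearP.
- move=> x; move: x; apply: (tensor_ind (min_algP X)) => [x y xE yE z|a b ha hb].
    by rewrite mulrDl !linearD xE yE mulrDl.
  apply: (tensor_ind (min_algP X)) => [x y xE yE|a' b' ha' hb'].
    by rewrite mulrDr !linearD xE yE mulrDr.
  by rewrite min_mul !hE min_mul gradingM.
- by rewrite -min_unit hE grading1.
- apply: (tensor_ind (min_algP X)) => [x y xE yE|a b ha hb].
    by rewrite starD !linearD xE yE starD.
  by rewrite min_star !hE min_star grading_star.
Qed.

End Twist.

(** * Comparison of the two norms *)

Lemma hnorm_ge0 (R : realType) (H : hilbertType R) (v : H) : 0 <= hnorm v.
Proof. exact: sqrtr_ge0. Qed.

Lemma le_opnorm (R : realType) (H : hilbertType R) (f : {linear H -> H}) (m : R) :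
  0 <= m -> (opnorm f <= m%:E)%E <-> forall v, hnorm (f v) <= m * hnorm v.
Proof.
move=> m0; split=> [fm v|fm].
  have [->|v0] := eqVneq v 0.
    by rewrite linear0 (is_norm0 (hnorm_is_norm H)) mulr0.
  have nv0 : 0 < hnorm v by rewrite -ltcR hnormE normr_gt0.
  rewrite -ler_pdivrMr//.
  have -> : hnorm (f v) / hnorm v = complex.Re `|f ((hnorm v)^-1%:C *: v)|.
    rewrite linearZ/= -hnorm_Re (is_normZ (hnorm_is_norm H)).
    by rewrite cabs_real ?invr_ge0 ?hnorm_ge0// mulrC.
  rewrite -lee_fin; apply: le_trans fm; apply: ereal_sup_ubound.
  exists ((hnorm v)^-1%:C *: v) => //=.
  rewrite -hnormE -(rmorph1 (real_complex R)) lecR (is_normZ (hnorm_is_norm H)).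
  by rewrite cabs_real ?invr_ge0 ?hnorm_ge0// mulVf ?gt_eqF.
apply: ge_ereal_sup => _ [v /= v1 <-]; rewrite lee_fin -hnorm_Re.
apply: le_trans (fm v) _; rewrite -[leRHS]mulr1 ler_wpM2l//.
by rewrite -lecR hnormE.
Qed.

Section CStarNorm.
Variables (R : realType) (C : cstarAlgType R).

Lemma cnorm_is_norm : is_norm (@cnorm R C).
Proof.
by split=> [x y|c x|x]; [exact: cnormD_le | exact: cnormZ | exact: cnorm_eq0].
Qed.

Lemma cnorm_exp (x : C) n : cnorm (x ^+ n.+1) <= cnorm x ^+ n.+1.
Proof.
elim: n => [//|n IH]; rewrite exprS [leRHS]exprS.
apply: le_trans (cnormM_le _ _) _.
by rewrite ler_wpM2l// (is_norm_ge0 cnorm_is_norm).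
Qed.

(** The C*-identity gives |y|^2 <= |y^*| |y|, hence |y| <= |y^*|; equality follows since [star] is
    an involution. *)
Lemma cnorm_star (x : C) : cnorm (star x) = cnorm x.
Proof.
suff le_star y : cnorm y <= cnorm (star y :> C).
  by apply/eqP; rewrite eq_le le_star -{2}[x]starK le_star.
have [->|y0] := eqVneq (cnorm y) 0; first exact: is_norm_ge0 cnorm_is_norm _.
have ny0 : 0 < cnorm y by rewrite lt_neqAle eq_sym y0 (is_norm_ge0 cnorm_is_norm).
by rewrite -(ler_pM2r ny0) -expr2 -cnorm_star_mul cnormM_le.
Qed.

End CStarNorm.

Lemma star1 (R : realType) (T : starAlgType R) : star 1 = 1 :> T.
Proof. by rewrite -[RHS]starK -[star 1 in RHS]mulr1 starM starK mulr1. Qed.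

(* Apply the bound to the powers (x^* x)^(2^n). *)
Lemma representation_bound (R : realType) (T : starAlgType R) (C : cstarAlgType R)
    (iota : {lrmorphism T -> C}) (W : lmodType R[i])
    (g : {dot W for (@Num.conj R[i])}) (s : T -> W -> W) (z : W) (k : R) :
  (forall x, iota (star x) = star (iota x)) ->
  is_dot_representation g s -> 0 <= k ->
  (forall x, dnorm g (s x z) <= k * cnorm (iota x)) ->
  forall x, dnorm g (s x z) <= cnorm (iota x) * dnorm g z.
Proof.
move=> iotaS [_ _ _ sM [_ sS]] k0 sk x.
have n_ge0 w : 0 <= dnorm g w by exact: sqrtr_ge0.
have m_ge0 y : 0 <= cnorm (iota y) by exact: is_norm_ge0 (@cnorm_is_norm R C) _.
have star_sq y : dnorm g (s y z) ^+ 2 <= dnorm g (s (star y * y) z) * dnorm g z.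
  rewrite dnormE_Re -sS -sM.
  exact: le_trans (ge_cabs_Re _) (dot_CauchySchwarz _ _ _).
pose h := star x * x.
have h_star n : star (h ^+ n) = h ^+ n.
  elim: n => [|n IH]; first by rewrite expr0 star1.
  by rewrite exprS starM IH starM starK -exprSr exprS.
have hz : dnorm g (s h z) <= cnorm (iota x) ^+ 2 * dnorm g z.
  rewrite -[h in s h z]expr1 -(expn0 2).
  (* Here s = |z| and q = |iota x|^2: [star_sq] gives the growth condition since the powers of [h]
     are selfadjoint, and [sk] gives the upper estimate with the constant [k]. *)
  apply: (@power_trick R (fun n => dnorm g (s (h ^+ (2 ^ n)) z)) _ k) => // [|n|n].
  - exact: exprn_ge0.
  - by rewrite (le_trans (star_sq _))// h_star -exprD addnn -mul2n -expnS.
  - apply: le_trans (sk _) _; rewrite ler_wpM2l// rmorphXn/=.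
    have -> : cnorm (iota x) ^+ 2 = cnorm (iota h).
      by rewrite -cnorm_star_mul -iotaS -rmorphM.
    by rewrite -(prednK (expn_gt0 2 n)) cnorm_exp.
rewrite -(@ler_pXn2r _ 2)// ?nnegrE ?mulr_ge0// (le_trans (star_sq x))//.
by rewrite exprMn [dnorm g z ^+ 2]expr2 mulrA ler_wpM2r.
Qed.

Lemma dense_bound (R : realType) (H : hilbertType R) (f : {linear H -> H})
    (A : set H) (m : R) : 0 <= m -> continuous f -> dense A ->
  (forall v, A v -> hnorm (f v) <= m * hnorm v) ->
  forall v, hnorm (f v) <= m * hnorm v.
Proof.
move=> m0 /linear_bounded_continuousP[k k0 fk] /dense_hnormP A_dense fA v.
have nP := hnorm_is_norm H; apply/ler_addgt0Pr => e e0.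
have mk0 : 0 < m + k + 1 by rewrite ltr_wpDl ?addr_ge0.
pose d := e / (m + k + 1); have d0 : 0 < d by rewrite divr_gt0.
have dE : d * (m + k + 1) = e by rewrite divfK// gt_eqF.
have [a Aa va] := A_dense v _ d0; clearbody d.
have := is_normD nP (f a) (f (v - a)); rewrite -linearD subrKC => h1.
have := is_normB nP v (v - a); rewrite opprB subrKC => h2.
have := fA _ Aa; have := fk (v - a).
have := ler_wpM2l k0 (ltW va); have := ler_wpM2l m0 (ltW va).
have := ler_wpM2l m0 h2; lra.
Qed.

Definition mk_scalar (R : realType) (A : lmodType R[i]) (f : A -> R[i])
    (fP : scalar f) : {scalar A} :=
  HB.pack f (GRing.isLinear.Build R[i] A R[i] *%R f fP).

(** * The spatial norm is at most the Fermi norm *)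

Section VectorStates.
Variables (R : realType) (A : gradedCStarAlgType R) (H : hilbertType R).
Variable pi : A -> {linear H -> H}.
Hypothesis piP : is_representation pi.

Lemma representation_star_mul a v : '[pi (star a * a) v, v] = '[pi a v, pi a v].
Proof. by case: piP => _ _ piM _ piS; rewrite piM piS. Qed.

Lemma vector_state_scalar v : scalar (fun a => '[pi a v, v]).
Proof. by case: piP => _ pil _ _ _ c a b; rewrite pil dotDl (dotZl inner). Qed.

(** As the grading is ad_u, the state at [grading a] is <a u v, u v> = |e|^2 <a v, v>. *)
Lemma eigenvector_state_even u e v : inner_grading u -> pi u v = e *: v ->
  e * Num.conj e = 1 -> '[v, v] = 1 ->
  is_even_state (mk_scalar (vector_state_scalar v)).
Proof.
case: piP => _ _ piM pi1 piS [su _ _ uE] ev ee v1; split; first split=> [a|] /=.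
- by rewrite representation_star_mul dot_ge0.
- by rewrite pi1.
move=> a /=; rewrite uE su !piM -[u in pi u (pi a _)]su piS ev (dotZr inner).
rewrite (linearZ_LR (pi a)) (dotZl inner).
by rewrite mulrA [_ * e]mulrC ee mul1r.
Qed.

Lemma even_part_state_scalar v : scalar (fun a => 2 * '[pi (even_part a) v, v]).
Proof.
move=> c a b; rewrite even_part_linear.
by have := vector_state_scalar v c (even_part a) (even_part b) => /= ->; ring.
Qed.

(** Twice the even part of a^* a is a^* a plus the same product formed from [grading a], whence
    positivity. The squared norm 1/2 offsets the factor 2, which arises from summing over the two
    copies of the doubled space. *)
Lemma even_part_state v : '[v, v] = 2^-1 ->
  is_even_state (mk_scalar (even_part_state_scalar v)).
Proof.
case: piP => _ pil _ pi1 _ v1; split; first split=> [a|] /=.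
- pose f := mk_scalar (vector_state_scalar v).
  suff : 0 <= 2 * f (even_part (star a * a)) by [].
  rewrite (linearZ_LR f) mulrA divff ?pnatr_eq0// mul1r (raddfD f)/=.
  by rewrite gradingM grading_star !representation_star_mul addr_ge0 ?dot_ge0.
- by rewrite even_part_id ?even1// pi1 v1 divff// pnatr_eq0.
by move=> a /=; rewrite /even_part gradingK addrC.
Qed.

End VectorStates.

Lemma normalize_dot (R : realType) (H : hilbertType R) (r : R) (v : H) :
  0 < r -> v != 0 -> exists2 c : R[i], c != 0 & '[c *: v, c *: v] = r%:C.
Proof.
move=> r0 v0; have nv0 : 0 < hnorm v by rewrite -ltcR hnormE normr_gt0.
have c0 : 0 < Num.sqrt r / hnorm v by apply: divr_gt0; rewrite ?(sqrtr_gt0 r).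
exists (Num.sqrt r / hnorm v)%:C.
  by rewrite -(rmorph0 (real_complex R)) (inj_eq (@complexI R)) gt_eqF.
rewrite -dnormE (is_normZ (dnorm_is_norm _)) -/(hnorm v) (cabs_real (ltW c0)).
by rewrite divfK ?gt_eqF// sqr_sqrtr// (ltW r0).
Qed.

Section SpatialLeFermi.
Variables (R : realType) (A B : gradedCStarAlgType R).
Variables (F : fermiTensor A B) (X : minTensor A B) (u : A).
Hypothesis uP : inner_grading u.
Local Notation tF := (fermi_pure F).
Local Notation tX := (min_pure X).
Local Notation emb := (fermi_emb F).
Variable h : {linear fermi_alg F -> min_alg X}.
Hypothesis hP : is_star_hom h.
Hypothesis hE : forall a b, h (tF a b) = twisted u tX a b.

Variables (H1 H2 K : hilbertType R).
Variables (pi1 : A -> {linear H1 -> H1}) (pi2 : B -> {linear H2 -> H2}).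
Variables (t : {bilinear H1 -> H2 -> K}) (rho : min_alg X -> {linear K -> K}).
Hypotheses (pi1P : is_representation pi1) (pi2P : is_representation pi2).
Hypotheses (tP : is_hilbert_tensor t) (rhoP : is_representation rho).
Hypothesis rhoE :
  forall a b v1 v2, rho (tX a b) (t v1 v2) = t (pi1 a v1) (pi2 b v2).

(** The constant may depend on [z], which makes the condition stable under sums and multiples;
    [representation_bound] replaces it by the norm of [z] at the end. *)
Let bounded_at (z : K) :=
  exists2 k, 0 <= k & forall x, hnorm (rho (h x) z) <= k * cnorm (emb x).

Let bounded_scale c z : bounded_at z -> bounded_at (c *: z).
Proof.
move=> [k k0 kz]; exists (cabs c * k) => [|x]; first by rewrite mulr_ge0 ?cabs_ge0.
rewrite (linearZ_LR (rho (h x))) (is_normZ (hnorm_is_norm K)) -mulrA.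
by rewrite ler_wpM2l ?cabs_ge0.
Qed.

Let bounded_add z z' : bounded_at z -> bounded_at z' -> bounded_at (z + z').
Proof.
move=> [k k0 kz] [k' k'0 kz']; exists (k + k') => [|x]; first by rewrite addr_ge0.
rewrite linearD (le_trans (is_normD (hnorm_is_norm K) _ _))// mulrDl.
by rewrite lerD.
Qed.

Let bounded0 : bounded_at 0.
Proof.
exists 0 => // x.
by rewrite linear0 mul0r (is_norm0 (hnorm_is_norm K)).
Qed.

(* Doubling K makes the state of B even: with the grading of B twisted in on the
   second copy, the two copies of t v w contribute to the value at tF a b
   <a v, v> <b_+ w, w> + <a u v, v> <b_- w, w> and
   <a v, v> <b_+ w, w> - <a u v, v> <b_- w, w>. *)
Let bounded_unit e v w : pi1 u v = e *: v -> e * Num.conj e = 1 ->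
  '[v, v] = 1 -> '[w, w] = 2^-1 -> bounded_at (t v w).
Proof.
move=> ev ee v1 w1.
have [gam gamP gamE] := grading_tensor_star_hom X.
have rho_rep := (is_dot_representationP rho).1 rhoP.
have s1 := star_hom_representation hP rho_rep.
have s2 := star_hom_representation hP (star_hom_representation gamP rho_rep).
have sP := sum_dot_representation s1 s2.
pose z := t v w.
have [H [i [pi [xi [piP xi_dense iE xiE piE]]]]] :=
  cyclic_subrepresentation (z, z) (@sum_dot_complete R K) sP.
have psi_lin : scalar (fun x => '[pi x xi, xi]).
  by case: piP => _ pil _ _ _ c x y; rewrite pil dotDl (dotZl inner).
have zz : '[z, z] = 2^-1 by rewrite tP.1 v1 w1 mul1r.
have xi1 : hnorm xi = 1.
  have xx : '[xi, xi] = 1.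
    by rewrite iE xiE -[LHS]/('[z, z] + '[z, z]) zz [RHS]splitr mul1r.
  by rewrite /hnorm /dnorm xx sqrtr1.
exists 1 => // x; rewrite mul1r.
(* The vector rho (h x) z is the first component of [pi x xi], seen in the doubled space. *)
have le_pi : hnorm (rho (h x) z) <= hnorm (pi x xi).
  rewrite {2}/hnorm /dnorm iE piE xiE.
  by have [] := sum_dnorm_ge (rho (h x) z, rho (gam (h x)) z).
apply: le_trans le_pi _.
have [_ embN _] := fermi_embP F.
(* As [xi] is a unit vector, it suffices to bound the operator norm of [pi x], which is one of the
   terms of the supremum defining the Fermi norm: (H, pi, xi) is the GNS triple of a product of even
   states. *)
rewrite -[leRHS]mulr1 -xi1; apply: (le_opnorm _ _).1.
  exact: is_norm_ge0 (@cnorm_is_norm R _) _.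
rewrite embN; apply: ereal_sup_ubound.
exists (mk_scalar (vector_state_scalar pi1P v)),
  (mk_scalar (even_part_state_scalar pi2P w)), (mk_scalar psi_lin), H, pi, xi.
split=> //.
- exact: eigenvector_state_even uP ev ee v1.
- exact: even_part_state.
- move=> a b /=.
  have rhoD x1 x2 y : rho (x1 + x2) y = rho x1 y + rho x2 y.
    by case: rhoP => _ rhol _ _ _; have := rhol 1 x1 x2 y; rewrite !scale1r.
  rewrite iE piE xiE.
  rewrite -[LHS]/('[rho (h (tF a b)) z, z] + '[rho (gam (h (tF a b))) z, z]).
  rewrite hE linearD !gamE !rhoD !rhoE.
  rewrite (elimT (evenP _) (even_partP b)) (elimT (oddP _) (odd_partP b)).
  have pi2N y y' : pi2 (- y) y' = - pi2 y y'.
    case: pi2P => _ pil _ _ _; have pil0 : pi2 0 y' = 0.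
      by have := pil (-1) 0 0 y'; rewrite scaler0 addr0 scaleN1r addNr.
    by have := pil (-1) y 0 y'; rewrite !scaleN1r addr0 pil0 addr0.
  set p := t _ _; set q := t _ _.
  rewrite pi2N linearNr -/q !dotDl dotNl addrACA subrr addr0 /p /z tP.1.
  by ring.
Qed.

Let bounded_eigenvector e v w : pi1 u v = e *: v -> e * Num.conj e = 1 ->
  bounded_at (t v w).
Proof.
move=> ev ee.
have [->|v0] := eqVneq v 0; first by rewrite linear0l; exact: bounded0.
have [->|w0] := eqVneq w 0; first by rewrite linear0r; exact: bounded0.
have [c c0 cv] := normalize_dot ltr01 v0.
have [|d d0 dw] := @normalize_dot R H2 2^-1 _ _ w0; first by rewrite invr_gt0.
have -> : t v w = (c * d)^-1 *: t (c *: v) (d *: w).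
  by rewrite linearZl_LR linearZr_LR/= !scalerA mulVf ?mulf_neq0// scale1r.
apply: bounded_scale; apply: (@bounded_unit e) => //.
- by rewrite (linearZ_LR (pi1 u)) ev !scalerA mulrC.
- by rewrite dw fmorphV rmorph_nat.
Qed.

(** Since [pi1 u] is an involution, v + u v and v - u v are eigenvectors for 1 and -1, and [v] is
    half their sum. *)
Let bounded_pure v w : bounded_at (t v w).
Proof.
pose v1 := v + pi1 u v; pose v2 := v - pi1 u v.
have uu : pi1 u (pi1 u v) = v.
  by case: pi1P => _ _ piM pi11 _; rewrite -piM inner_gradingK.
have -> : t v w = 2^-1 *: (t v1 w + t v2 w).
  by rewrite -linearDl addrACA subrr addr0 linearDl half_add.
apply: bounded_scale; apply: bounded_add.
- apply: (@bounded_eigenvector 1); last by rewrite rmorph1 mulr1.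
  by rewrite linearD uu addrC scale1r.
- apply: (@bounded_eigenvector (-1)); last by rewrite rmorphN1 mulrNN mulr1.
  by rewrite linearB uu scaleN1r opprB.
Qed.

Lemma representation_le_fermi x : (opnorm (rho (h x)) <= fermi_norm tF x)%E.
Proof.
have [embS embN _] := fermi_embP F.
have m0 : 0 <= cnorm (emb x) by exact: is_norm_ge0 (@cnorm_is_norm R _) _.
rewrite -embN; apply/le_opnorm => //.
apply: dense_bound tP.2 _ => //; first by case: rhoP.
move=> _ [s ->].
have [k k0 kz] : bounded_at (\sum_(p <- s) t p.1 p.2).
  elim: s => [|p s IH]; first by rewrite big_nil; exact: bounded0.
  by rewrite big_cons; apply: bounded_add IH; exact: bounded_pure.
have rho_rep := (is_dot_representationP rho).1 rhoP.
exact: (representation_bound embS (star_hom_representation hP rho_rep) k0 kz).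
Qed.

End SpatialLeFermi.

Lemma spatial_le_fermi (R : realType) (A B : gradedCStarAlgType R)
    (F : fermiTensor A B) (X : minTensor A B) (u : A)
    (h : {linear fermi_alg F -> min_alg X}) x :
  inner_grading u -> is_star_hom h ->
  (forall a b, h (fermi_pure F a b) = twisted u (min_pure X) a b) ->
  (spatial_norm (min_pure X) (h x) <= fermi_norm (fermi_pure F) x)%E.
Proof.
move=> uP hP hE; apply: ge_ereal_sup => r.
move=> [H1 [H2 [K [pi1 [pi2 [t [rho [[pi1P pi2P] tP rhoP rhoE ->]]]]]]]].
exact: (representation_le_fermi uP hP hE pi1P pi2P tP rhoP rhoE).
Qed.

(** * The Fermi norm is at most the spatial norm *)

Lemma cabs_is_norm (R : realType) : is_norm (@cabs R : R[i]^o -> R).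
Proof.
split=> [x y|c x|x].
- by rewrite -lecR rmorphD/= !cabsE ler_normD.
- by apply: complexI; rewrite rmorphM/= !cabsE normrM.
- by move=> x0; apply/eqP; rewrite -normr_eq0 -cabsE x0.
Qed.

Lemma dot_dense_eq (R : realType) (H K : hilbertType R) (V : lmodType R[i])
    (q : V -> H) (f : {linear H -> K}) (k : R) (c : R[i]) (y : K) (y' : H) :
  dense (range q) -> (forall v, hnorm (f v) <= k * hnorm v) ->
  (forall v, '[f (q v), y] = c * '[q v, y']) -> forall v, '[f v, y] = c * '[v, y'].
Proof.
move=> /dense_hnormP q_dense fk fq.
have q_dense' v (e : R) : 0 < e -> exists v', hnorm (v - q v') < e.
  by move=> /(q_dense v)[_ [v' _ <-]]; exists v'.
apply: (lipschitz_dense_eq (hnorm_is_norm H) (@cabs_is_norm R) q_dense'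
  (k := k * hnorm y) (k' := cabs c * hnorm y')) => //.
- move=> v v'; rewrite -dotNl -dotDl -linearB.
  apply: le_trans (dot_CauchySchwarz _ _ _) _.
  by rewrite mulrAC ler_wpM2r ?hnorm_ge0 ?fk.
- move=> v v'; rewrite -mulrBr -dotNl -dotDl.
  rewrite (is_normZ (@cabs_is_norm R)) -mulrA ler_wpM2l ?cabs_ge0// mulrC.
  exact: dot_CauchySchwarz.
Qed.

Lemma linear_dense_eq (R : realType) (H K : hilbertType R) (V : lmodType R[i])
    (q : V -> H) (f g : {linear H -> K}) (k k' : R) :
  dense (range q) -> (forall v, hnorm (f v) <= k * hnorm v) ->
  (forall v, hnorm (g v) <= k' * hnorm v) ->
  (forall v, f (q v) = g (q v)) -> f =1 g.
Proof.
move=> /dense_hnormP q_dense fk gk fg.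
have q_dense' v (e : R) : 0 < e -> exists v', hnorm (v - q v') < e.
  by move=> /(q_dense v)[_ [v' _ <-]]; exists v'.
apply: (lipschitz_dense_eq (hnorm_is_norm H) (hnorm_is_norm K) q_dense'
  (k := k) (k' := k')) => // v v'; by rewrite -linearB.
Qed.

Section ProductVector.
Variables (R : realType) (A B : gradedCStarAlgType R) (X : minTensor A B).
Local Notation tX := (min_pure X).
Variables (H : hilbertType R) (rho : min_alg X -> {linear H -> H}) (xi : H).
Hypotheses (rhoP : is_representation rho).
Hypothesis xi_dense : dense (range (fun x => rho x xi)).
Variables (w : A -> R[i]) (phi : B -> R[i]).
Hypotheses (w1 : w 1 = 1) (phi1 : phi 1 = 1).
Hypothesis xiE : forall a b, '[rho (tX a b) xi, xi] = w a * phi b.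

Let left_star_hom : is_star_hom (fun a : A => tX a 1).
Proof.
split=> [c a a'|a a'||a].
- by rewrite linearDl linearZl_LR.
- by rewrite min_mul mulr1.
- exact: min_unit.
- by rewrite min_star star1.
Qed.

Let right_star_hom : is_star_hom (fun b : B => tX 1 b).
Proof.
split=> [c b b'|b b'||b].
- by rewrite linearDr linearZr_LR.
- by rewrite min_mul mulr1.
- exact: min_unit.
- by rewrite min_star star1.
Qed.

(** The vector [xi] plays the role of xi1 (x) xi2: with H1 and H2 the cyclic spaces of the two
    factors, [t] sends (a xi1, v) to (a (x) 1) v. The product form of the vector state makes [t]
    multiplicative for inner products, and cyclicity of [xi] makes its range span a dense
    subspace. *)
Lemma product_vector_tensor :
  exists (H1 H2 : hilbertType R) (pi1 : A -> {linear H1 -> H1})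
    (pi2 : B -> {linear H2 -> H2}) (t : {bilinear H1 -> H2 -> H}),
  [/\ is_representation pi1, is_representation pi2, is_hilbert_tensor t &
      forall a b v1 v2, rho (tX a b) (t v1 v2) = t (pi1 a v1) (pi2 b v2)].
Proof.
have rho_rep := (is_dot_representationP rho).1 rhoP.
have [H1 [i1 [pi1 [xi1 [pi1P dense1 i1E i1xi pi1E]]]]] :=
  cyclic_subrepresentation xi (@hnorm_complete R H)
    (star_hom_representation left_star_hom rho_rep).
have [H2 [i2 [pi2 [xi2 [pi2P dense2 i2E i2xi pi2E]]]]] :=
  cyclic_subrepresentation xi (@hnorm_complete R H)
    (star_hom_representation right_star_hom rho_rep).
rewrite /= in pi1E pi2E.
have rhob x : exists2 k, 0 <= k & forall v, hnorm (rho x v) <= k * hnorm v.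
  by case: rho_rep => rb _ _ _ _; exact: rb.
have i2n v : hnorm (i2 v) = hnorm v by rewrite /hnorm /dnorm i2E.
case: (rhoP) => _ rhol rhoM rho1 rhoS.
have left_lin a : linear (fun v => rho (tX a 1) (i2 v)).
  by move=> c v v'; rewrite !linearP.
pose m a : {linear H2 -> H} := mk_linear (left_lin a).
have mb a : exists2 k, 0 <= k & forall v, hnorm (m a v) <= k * hnorm v.
  by have [k k0 rk] := rhob (tX a 1); exists k => // v; rewrite -i2n rk.
have m_gen a b : m a (pi2 b xi2) = rho (tX a b) xi.
  by rewrite /m/= pi2E i2xi -rhoM min_mul mul1r mulr1.
have dot_gen a b a' b' : '[rho (tX a b) xi, rho (tX a' b') xi] =
    w (star a' * a) * phi (star b' * b).
  by rewrite -rhoS -rhoM min_star min_mul xiE.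
have pi1_dot a a' : '[pi1 a xi1, pi1 a' xi1] = w (star a' * a).
  by rewrite i1E !pi1E i1xi dot_gen star1 mulr1 phi1 mulr1.
have pi2_dot b b' : '[pi2 b xi2, pi2 b' xi2] = phi (star b' * b).
  by rewrite i2E !pi2E i2xi dot_gen star1 mulr1 w1 mul1r.
(* So m a is a multiple of an isometry, with the factor |a xi|: this is what
   extends (a xi1, v) |-> m a v to H1. *)
have m_dot a a' v v' : '[m a v, m a' v'] = '[pi1 a xi1, pi1 a' xi1] * '[v, v'].
  have m_dot_gen a1 a2 b y :
      '[m a1 y, m a2 (pi2 b xi2)] = '[pi1 a1 xi1, pi1 a2 xi1] * '[y, pi2 b xi2].
    have [k _ mk] := mb a1; apply: dot_dense_eq dense2 mk _ _ => b'.
    by rewrite !m_gen dot_gen pi1_dot pi2_dot.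
  (* [m_dot_gen] leaves the left vector arbitrary; Hermitian symmetry reduces the right one to the
     same density argument. *)
  rewrite (dotC _ (m a v)) (dotC _ (pi1 a xi1)) (dotC _ v) -rmorphM; congr Num.conj.
  have [k _ mk] := mb a'; apply: dot_dense_eq dense2 mk _ v' => b'.
  rewrite [LHS]dotC m_dot_gen rmorphM; congr (_ * _); exact/esym/dotC.
have m_norm v a : hnorm (m a v) = hnorm v * hnorm (pi1 a xi1).
  apply/eqP; rewrite -(@eqrXn2 _ 2)// ?mulr_ge0 ?hnorm_ge0//; apply/eqP/complexI.
  by rewrite exprMn [RHS]rmorphM /hnorm /= !dnormE m_dot mulrC.
have dense1' v (e : R) : 0 < e -> exists a, hnorm (v - pi1 a xi1) < e.
  move=> e0; move/dense_hnormP: dense1 => /(_ v e e0)[_ [a _ <-]].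
  by exists a.
have orb1_lin : linear (fun a => pi1 a xi1).
  by case: pi1P => _ pil _ _ _ c a b; rewrite pil.
have m_lin v : linear (fun a => m a v).
  by move=> c a a'; rewrite /m/= linearDl linearZl_LR rhol.
(* The second argument is fixed first: [m_norm] bounds the map on the orbit of [xi1] by the norm of
   [v2], and t v1 v2 will be T v2 v1. *)
have T_ex v2 : exists T : {linear H1 -> H},
    (forall a, T (pi1 a xi1) = m a v2) /\
    (forall v, hnorm (T v) <= hnorm v2 * hnorm v).
  have [|T TE Tn] := dense_extension (hnorm_is_norm H1) (hnorm_is_norm H) dense1'
    orb1_lin (m_lin v2) (hnorm_ge0 v2) _ (@hnorm_complete R H); last by exists T.
  by move=> a; rewrite m_norm.
have [T TP] := choice T_ex.
have TE v2 a : T v2 (pi1 a xi1) = m a v2 by case: (TP v2).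
have Tn v2 v : hnorm (T v2 v) <= hnorm v2 * hnorm v by case: (TP v2).
(* The maps T v2 are chosen one by one; linearity in [v2] holds on the dense orbit of [xi1] and
   extends by boundedness. *)
have T_lin v1 : linear (fun v2 => T v2 v1).
  move=> c v2 v2'; have cT_lin : linear (fun v => c *: T v2 v + T v2' v).
    move=> d v v'; rewrite (linearP (T v2)) (linearP (T v2')).
    rewrite !scalerDr !scalerA [c * d]mulrC.
    by rewrite addrACA.
  apply: (linear_dense_eq (f := T (c *: v2 + v2')) (g := mk_linear cT_lin)
    (k' := cabs c * hnorm v2 + hnorm v2') dense1 (Tn _)) => [v|a] /=.
    apply: le_trans (is_normD (hnorm_is_norm H) _ _) _.
    rewrite (is_normZ (hnorm_is_norm H)) mulrDl -mulrA lerD//.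
    by rewrite ler_wpM2l ?cabs_ge0.
  by rewrite !TE linearP.
pose t : {bilinear H1 -> H2 -> H} :=
  HB.pack (fun v1 v2 => T v2 v1) (bilinear_isBilinear.Build R[i] H1 H2 H *:%R *:%R
    (fun v1 v2 => T v2 v1) ((fun v2 => @linearP _ _ _ _ (T v2)), T_lin)).
have t_gen a v2 : t (pi1 a xi1) v2 = m a v2 by exact: TE.
have t_dot v1 v2 v1' v2' : '[t v1 v2, t v1' v2'] = '[v1, v1'] * '[v2, v2'].
  have t_dot_gen a y y2 y2' :
      '[t y y2, t (pi1 a xi1) y2'] = '[y2, y2'] * '[y, pi1 a xi1].
    apply: (dot_dense_eq (f := T y2) dense1 (Tn y2)) => a'.
    by rewrite TE t_gen m_dot mulrC.
  rewrite mulrC (dotC _ (t v1 v2)) (dotC _ v1) (dotC _ v2) -rmorphM.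
  congr Num.conj.
  apply: (dot_dense_eq (f := T v2') dense1 (Tn v2')) => a.
  rewrite [LHS]dotC t_dot_gen rmorphM; congr (_ * _); exact/esym/dotC.
exists H1, H2, pi1, pi2, t; split=> //.
  split=> //; apply/dense_hnormP => v e e0.
  move/dense_hnormP: xi_dense => /(_ v e e0)[_ [x _ <-] vx].
  exists (rho x xi) => //=; have [s ->] := (min_algP X).1 x.
  exists [seq (pi1 p.1 xi1, pi2 p.2 xi2) | p <- s].
  have orb_lin : linear (fun x => rho x xi) by move=> c y y'; rewrite rhol.
  rewrite big_map -[LHS]/(mk_linear orb_lin _) linear_sum; apply: eq_bigr => p _ /=.
  by rewrite TE m_gen.
move=> a b v1 v2.
have [k k0 rk] := rhob (tX a b).
have [k1 k10 pk] : exists2 k, 0 <= k & forall v, hnorm (pi1 a v) <= k * hnorm v.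
  by case: pi1P => /(_ a)/linear_bounded_continuousP.
(* Both sides are bounded and linear in the first vector, so it is enough to compare them on the
   orbit of [xi1]. *)
apply: (linear_dense_eq (f := rho (tX a b) \o T v2) (g := T (pi2 b v2) \o pi1 a)
  (k := k * hnorm v2) (k' := hnorm (pi2 b v2) * k1) dense1) => [v|v|a'] /=.
- by rewrite (le_trans (rk _))// -mulrA ler_wpM2l.
- by rewrite (le_trans (Tn _ _))// -mulrA ler_wpM2l ?hnorm_ge0.
- case: (pi1P) => _ _ pi1M _ _; rewrite -pi1M !TE /m/= pi2E -!rhoM !min_mul.
  by rewrite mulr1 mul1r mulr1.
Qed.

End ProductVector.

Lemma fermi_le_spatial (R : realType) (A B : gradedCStarAlgType R)
    (F : fermiTensor A B) (X : minTensor A B) (u : A)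
    (h : {linear fermi_alg F -> min_alg X}) (k : {linear min_alg X -> fermi_alg F})
    x :
  cancel h k -> is_star_hom k ->
  (forall a b, k (min_pure X a b) = twisted u (fermi_pure F) a b) ->
  (fermi_norm (fermi_pure F) x <= spatial_norm (min_pure X) (h x))%E.
Proof.
move=> hk kP kE; apply: ge_ereal_sup => r.
move=> [w [phi [psi [H [pi [xi [wP phiP psiE [piP xi_dense piE] ->]]]]]]].
case: wP phiP => [[_ w1] _] [[_ phi1] phiE].
pose rho y := pi (k y).
have rhoP : is_representation rho.
  apply/is_dot_representationP.
  exact: star_hom_representation kP ((is_dot_representationP pi).1 piP).
have rho_dense : dense (range (fun y => rho y xi)).
  apply/dense_hnormP => v e e0.
  move/dense_hnormP: xi_dense => /(_ v e e0)[_ [y _ <-] vy].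
  by exists (pi y xi) => //; exists (h y) => //; rewrite /rho hk.
have rhoE a b : '[rho (min_pure X a b) xi, xi] = w a * phi b.
  have phi_odd : phi (odd_part b) = 0.
    have := phiE (odd_part b); rewrite (elimT (oddP _) (odd_partP b)) raddfN.
    by move/eqP; rewrite eq_sym -addr_eq0 -mulr2n mulrn_eq0 => /eqP.
  have psiD y z : psi (y + z) = psi y + psi z by exact: raddfD.
  rewrite /rho kE -piE /twisted psiD !psiE phi_odd mulr0 addr0.
  have phiD y z : phi (y + z) = phi y + phi z by exact: raddfD.
  by rewrite -{2}(parts_add b) phiD phi_odd addr0.
have [H1 [H2 [pi1 [pi2 [t [pi1P pi2P tP tE]]]]]] :=
  product_vector_tensor rhoP rho_dense w1 phi1 rhoE.
apply: ereal_sup_ubound.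
exists H1, H2, H, pi1, pi2, t, rho; split=> //.
by rewrite /rho hk.
Qed.

(** * Continuity of star homomorphisms and completions *)

Lemma half_exp_small (R : realType) (e : R) : 0 < e ->
  exists N : nat, 2^-1 ^+ N < e.
Proof.
move=> e0; have [N NP] := inv_nat_small e0; exists N.
apply: le_lt_trans (NP N (leqnn _)); rewrite exprVn lef_pV2 ?posrE ?exprn_gt0//.
by rewrite -natrX ler_nat ltn_expl.
Qed.

Section SquareRoot.
Variables (R : realType) (C : cstarAlgType R).
Local Notation nP := (@cnorm_is_norm R C).

Let n_ge0 (x : C) : 0 <= cnorm x. Proof. exact: is_norm_ge0 nP _. Qed.

Lemma cnorm_half (x : C) : cnorm (2^-1 *: x) = 2^-1 * cnorm x.
Proof.
by rewrite cnormZ -/(cabs _) -(rmorph_nat (real_complex R)) -fmorphV cabs_real.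
Qed.

Lemma cnorm_sqrB_le (x y : C) :
  cnorm (x * x - y * y) <= (cnorm x + cnorm y) * cnorm (x - y).
Proof.
have -> : x * x - y * y = x * (x - y) + (x - y) * y.
  by rewrite mulrBr mulrBl addrA subrK.
rewrite (le_trans (cnormD_le _ _))// [leRHS]mulrDl lerD ?cnormM_le//.
by rewrite (le_trans (cnormM_le _ _))// mulrC.
Qed.

Variable p : C.
Hypothesis p_small : cnorm p <= 2^-1.

(* A fixed point y of this iteration satisfies (1 - y)^2 = 1 - p. *)
Let step (y : C) := 2^-1 *: (p + y * y).
Let approx n := iter n step 0.

Let approx_bound n : cnorm (approx n) <= 2^-1.
Proof.
elim: n => [|n IH]; first by rewrite /approx /= (is_norm0 nP).
rewrite /approx iterS -/(approx n) /step cnorm_half.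
have h1 := cnormD_le p (approx n * approx n).
have h2 := cnormM_le (approx n) (approx n).
have h3 := ler_pM (n_ge0 _) (n_ge0 _) IH IH.
rewrite ler_pdivrMl//; apply: le_trans h1 _.
apply: le_trans (lerD p_small (le_trans h2 h3)) _; lra.
Qed.

(** On the ball of radius 1/2 squaring is 1-Lipschitz, so the factor 1/2 in [step] makes it a
    contraction. *)
Let approx_contract n m : cnorm (approx (n + m) - approx n) <= 2^-1 ^+ n.
Proof.
elim: n => [|n IH].
  by rewrite subr0 expr0 (le_trans (approx_bound _))// invf_le1// ler1n.
rewrite addSn /approx !iterS -/(approx _) -/(approx n) /step -scalerBr cnorm_half.
rewrite exprS ler_wpM2l ?invr_ge0//; apply: le_trans IH.
rewrite opprD addrACA subrr add0r.
apply: le_trans (cnorm_sqrB_le _ _) _; rewrite -[leRHS]mul1r ler_wpM2r//.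
by rewrite [leRHS]splitr mul1r lerD.
Qed.

(** The iterates are polynomials in [p] with rational coefficients, so they are selfadjoint when [p]
    is and commute with whatever commutes with [p]; both properties pass to the limit. *)
Lemma sqrt_one_minus : exists y : C, [/\ (1 - y) * (1 - y) = 1 - p,
   star p = p -> star y = y & forall x, x * p = p * x -> x * y = y * x].
Proof.
have [|y y_lim] := cnorm_complete approx.
  move=> e e0; have e2 : 0 < e / 2 by rewrite divr_gt0.
  have [N NP] := half_exp_small e2.
  exists N => m n /subnKC <- /subnKC <-.
  apply: le_lt_trans (is_norm_dist nP (approx N) _ _) _.
  rewrite (is_normBC nP (approx N)) [e]splitr.
  by rewrite ltrD// (le_lt_trans (approx_contract _ _)).
have y_lim2 (e : R) : 0 < e -> exists n, cnorm (approx n - y) < e /\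
    cnorm (approx n.+1 - y) < e.
  by move=> /y_lim[N NP]; exists N; split; apply: NP.
exists y; split.
- have yE : y = 2^-1 *: (p + y * y).
    apply/eqP; rewrite -subr_eq0; apply/eqP/(is_norm_small0 nP) => e e0.
    (* With d = e / (|y| + 2) bounding both errors, the distance from [y] to its image under [step]
       is at most d + (1/2)(1/2 + |y|) d, which is below [e]. *)
    have d0 : 0 < cnorm y + 2 by rewrite ltr_wpDl.
    have [n [yn yn1]] := y_lim2 _ (divr_gt0 e0 d0).
    have stepE : approx n.+1 - 2^-1 *: (p + y * y) =
        2^-1 *: (approx n * approx n - y * y).
      by rewrite /approx iterS -scalerBr opprD addrACA subrr add0r.
    have := is_norm_dist nP (approx n.+1) y (2^-1 *: (p + y * y)).
    rewrite stepE cnorm_half (is_normBC nP y (approx n.+1)).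
    have := cnorm_sqrB_le (approx n) y.
    have := ler_wpM2r (n_ge0 (approx n - y)) (approx_bound n).
    move: yn yn1; rewrite !ltr_pdivlMr//.
    have := n_ge0 (approx n - y); have := n_ge0 (approx n.+1 - y).
    have := mulr_ge0 (n_ge0 y) (n_ge0 (approx n - y)).
    have := mulr_ge0 (n_ge0 y) (n_ge0 (approx n.+1 - y)).
    lra.
  have py : p + y * y = y + y.
    by rewrite [in RHS]yE -scalerDr half_add.
  have yy : y * y = y + y - p by rewrite -py addrC addKr.
  rewrite mulrBr mulr1 mulrBl mul1r yy opprB [y + y - p - y]addrAC addrK.
  exact: subrKA.
- move=> pS; have aS n : star (approx n) = approx n.
    elim: n => [|n IH].
      by rewrite /approx /= -(scale0r (0 : C)) starZ rmorph0 !scale0r.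
    rewrite /approx iterS -/(approx n) /step starZ starD starM IH pS.
    by rewrite fmorphV rmorph_nat.
  apply/eqP; rewrite -subr_eq0; apply/eqP/(is_norm_small0 nP) => e e0.
  have e2 : 0 < e / 2 by rewrite divr_gt0.
  have [n [yn _]] := y_lim2 _ e2.
  have := is_norm_dist nP (approx n) (star y) y.
  have -> : star y - approx n = star (y - approx n) by rewrite starD starN aS.
  rewrite cnorm_star (is_normBC nP y) => h1; apply: le_lt_trans h1 _.
  by rewrite [e]splitr ltrD.
- move=> x xp; have ax n : x * approx n = approx n * x.
    elim: n => [|n IH]; first by rewrite /approx /= mulr0 mul0r.
    rewrite /approx iterS -/(approx n) /step -scalerAr -scalerAl mulrDr mulrDl xp.
    by rewrite mulrA IH -mulrA IH mulrA.
  apply/eqP; rewrite -subr_eq0; apply/eqP/(is_norm_small0 nP) => e e0.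
  have d0 : 0 < 2 * cnorm x + 1 by rewrite ltr_wpDl ?mulr_ge0.
  have [n [yn _]] := y_lim2 _ (divr_gt0 e0 d0).
  have := is_norm_dist nP (approx n * x) (x * y) (y * x).
  have -> : x * y - approx n * x = x * (y - approx n) by rewrite mulrBr ax.
  rewrite -mulrBl; have := cnormM_le x (y - approx n).
  have := cnormM_le (approx n - y) x; rewrite (is_normBC nP y).
  move: yn; rewrite ltr_pdivlMr// => yn.
  have := n_ge0 (approx n - y); lra.
Qed.

End SquareRoot.

Lemma cnorm1_le (R : realType) (C : cstarAlgType R) : cnorm (1 : C) <= 1.
Proof.
have n0 : 0 <= cnorm (1 : C) by exact: is_norm_ge0 (@cnorm_is_norm R C) _.
have := cnorm_star_mul (1 : C); rewrite star1 mulr1 expr2; nra.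
Qed.

(* With c = sqrt (1 - x^2), the selfadjoint x is the real part of the unitary
   x + ic, and the image of a unitary is a unitary. *)
Lemma star_hom_selfadjoint (R : realType) (C D : cstarAlgType R) (f : C -> D)
    (x : C) : is_star_hom f -> star x = x -> cnorm x <= 2^-1 -> cnorm (f x) <= 1.
Proof.
move=> [fl fM f1 fS] xS x_small.
have xx_small : cnorm (x * x) <= 2^-1.
  have := cnormM_le x x; have := is_norm_ge0 (@cnorm_is_norm R C) x; nra.
have [y [y1 yS yC]] := sqrt_one_minus xx_small.
pose c := 1 - y.
have cS : star c = c by rewrite /c starD starN star1 yS// starM xS.
have xc : x * c = c * x by rewrite /c mulrBr mulrBl mulr1 mul1r yC// mulrA.
pose v := x + 'i *: c; pose v' := x - 'i *: c.
have vS : star v = v'.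
  by rewrite /v starD starZ xS cS conjCi scaleNr.
have vv : v' * v = 1.
  have icx : ('i *: c) * x = 'i *: (c * x) by rewrite -scalerAl.
  have xic : x * ('i *: c) = 'i *: (c * x) by rewrite -scalerAr xc.
  have icic : ('i *: c) * ('i *: c) = - (c * c).
    by rewrite -scalerAl -scalerAr scalerA -expr2 sqrCi scaleN1r.
  rewrite /v /v' mulrBl !mulrDr icx xic icic opprD opprK addrA addrK y1.
  by rewrite addrC subrK.
have fv : cnorm (f v) <= 1.
  have := cnorm_star_mul (f v); rewrite -fS vS -fM vv f1.
  have := cnorm1_le D; have := is_norm_ge0 (@cnorm_is_norm R D) (f v); nra.
have -> : f x = 2^-1 *: (f v + star (f v)).
  have fD z z' : f (z + z') = f z + f z'.
    by have := fl 1 z z'; rewrite !scale1r.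
  by rewrite -fS vS -fD /v /v' addrACA subrr addr0 fD half_add.
have := cnormD_le (f v) (star (f v)); rewrite cnorm_half cnorm_star; lra.
Qed.

(** Selfadjoint elements are rescaled to norm 1/2, which explains the constant 2; the C*-identity
    applied to x^* x gives the general case. A crude constant is enough for continuity. *)
Lemma star_hom_bounded (R : realType) (C D : cstarAlgType R) (f : C -> D) :
  is_star_hom f -> forall x, cnorm (f x) <= 2 * cnorm x.
Proof.
move=> fP x; have nC := @cnorm_is_norm R C; have nD := @cnorm_is_norm R D.
case: (fP) => fl fM f1 fS.
have fZ c y : f (c *: y) = c *: f y.
  have f0 : f 0 = 0 by have := fl (-1) 0 0; rewrite scaler0 addr0 scaleN1r addNr.
  by have := fl c y 0; rewrite !addr0 f0 addr0.
have sq_bound y : star y = y -> cnorm (f y) <= 2 * cnorm y.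
  move=> yS; have [->|y0] := eqVneq y 0.
    by rewrite -(scale0r (0 : C)) fZ scale0r (is_norm0 nD) mulr_ge0// is_norm_ge0.
  have ny0 : 0 < cnorm y.
    rewrite lt_neqAle is_norm_ge0// andbT eq_sym.
    by apply: contra y0 => /eqP/cnorm_eq0/eqP.
  pose r := (2 * cnorm y)^-1; have r0 : 0 < r by rewrite invr_gt0 mulr_gt0.
  have : cnorm (f (r%:C *: y)) <= 1.
    apply: star_hom_selfadjoint => //.
      by rewrite starZ yS conj_Creal ?ger0_real ?ler0c ?ltW.
    by rewrite (is_normZ nC) cabs_real ?(ltW r0)// /r invfM mulrVK// unitfE gt_eqF.
  rewrite fZ (is_normZ nD) cabs_real ?(ltW r0)//.
  by rewrite ler_pdivrMl ?mulr_gt0// mulr1.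
rewrite -(@ler_pXn2r _ 2)// ?nnegrE ?mulr_ge0 ?is_norm_ge0//.
rewrite -cnorm_star_mul -fS -fM; apply: le_trans (sq_bound _ _) _.
  by rewrite starM starK.
rewrite cnorm_star_mul exprMn ler_wpM2r ?sqr_ge0//.
by rewrite expr2; lra.
Qed.

(** * Extension of *-homomorphisms to completions *)

Section CompletionExtension.
Variables (R : realType) (S T : starAlgType R) (C D : cstarAlgType R).
Variables (iS : {lrmorphism S -> C}) (iT : {lrmorphism T -> D}).
Hypotheses (iS_star : forall x, iS (star x) = star (iS x)).
Hypotheses (iT_star : forall x, iT (star x) = star (iT x)).
Hypothesis iS_dense : forall c (e : R), 0 < e -> exists x, cnorm (c - iS x) < e.
Variable h : {linear S -> T}.
Hypothesis hP : is_star_hom h.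
Hypothesis h_norm : forall x, cnorm (iT (h x)) <= cnorm (iS x).

Let nC := @cnorm_is_norm R C.
Let nD := @cnorm_is_norm R D.

Lemma completion_extension : exists f : {linear C -> D},
  [/\ is_star_hom f, forall x, f (iS x) = iT (h x) &
      forall c, cnorm (f c) <= cnorm c].
Proof.
case: (hP) => _ hM h1 hS.
have [|f fE fn] := dense_extension nC nD iS_dense (linearP iS)
  (linearP (iT \o h)) ler01 _ (@cnorm_complete R D).
  by move=> x; rewrite mul1r h_norm.
have f_lip c c' : cnorm (f c - f c') <= 1 * cnorm (c - c').
  by rewrite -linearB.
have f_lip1 c : cnorm (f c) <= cnorm c by rewrite -[leRHS]mul1r.
exists f; split=> [|//|c]; last by rewrite -[leRHS]mul1r.
split.
- by move=> a c c'; rewrite linearP.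
(* Multiplicativity is extended one factor at a time: first the right factor by density, then the
   left. *)
- have f_iS x c' : f (iS x * c') = f (iS x) * f c'.
    apply: (lipschitz_dense_eq nC nD iS_dense (f := fun c' => f (iS x * c'))
      (g := fun c' => f (iS x) * f c') (k := cnorm (iS x))
      (k' := cnorm (f (iS x)))) => [c1 c2|c1 c2|y].
    - rewrite -linearB -mulrBr (le_trans (f_lip1 _))//; exact: cnormM_le.
    - rewrite -mulrBr -linearB (le_trans (cnormM_le _ _))//.
      by rewrite ler_wpM2l ?(is_norm_ge0 nD)// f_lip1.
    - by rewrite -rmorphM !fE /= hM rmorphM.
  move=> c c'; move: c.
  apply: (lipschitz_dense_eq nC nD iS_dense (f := fun c => f (c * c'))
    (g := fun c => f c * f c') (k := cnorm c')
    (k' := cnorm (f c'))) => [c1 c2|c1 c2|y].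
  - rewrite -linearB -mulrBl (le_trans (f_lip1 _))// mulrC; exact: cnormM_le.
  - rewrite -mulrBl -linearB (le_trans (cnormM_le _ _))// mulrC.
    by rewrite ler_wpM2l ?(is_norm_ge0 nD)// f_lip1.
  - exact: f_iS.
- by rewrite -(rmorph1 iS) fE /= h1 rmorph1.
- apply: (lipschitz_dense_eq nC nD iS_dense (f := fun c => f (star c))
    (g := fun c => star (f c)) (k := 1) (k' := 1)) => [c1 c2|c1 c2|y].
  - by rewrite (le_trans (f_lip _ _))// -starN -starD cnorm_star.
  - by rewrite -starN -starD cnorm_star f_lip.
  - by rewrite -iS_star !fE /= hS iT_star.
Qed.

End CompletionExtension.

Theorem proposition3p1 (R : realType) (A B : gradedCStarAlgType R)
    (F : fermiTensor A B) (X : minTensor A B) :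
  (exists u : A, inner_grading u) -> graded_isomorphic F X.
Proof.
move=> [u uP].
have [h [k [[hP kP] hk kh hE kE]]] := twist_isomorphism F X uP.
have [embF_star embF_norm embF_dense] := fermi_embP F.
have [embX_star embX_norm embX_dense] := min_embP X.
have h_norm x : cnorm (min_emb X (h x)) = cnorm (fermi_emb F x).
  apply/eqP; rewrite eq_le -!lee_fin embF_norm embX_norm.
  by rewrite (fermi_le_spatial _ hk kP kE) (spatial_le_fermi _ uP hP hE).
have [|f [fP fE fn]] := completion_extension embF_star embX_star embF_dense hP.
  by move=> x; rewrite h_norm.
have [|g [gP gE gn]] := completion_extension embX_star embF_star embX_dense kP.
  by move=> y; rewrite -h_norm kh.
have nF := @cnorm_is_norm R F; have nX := @cnorm_is_norm R X.
have f_lip c c' : cnorm (f c - f c') <= 1 * cnorm (c - c').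
  by rewrite -linearB mul1r.
have g_lip c c' : cnorm (g c - g c') <= 1 * cnorm (c - c').
  by rewrite -linearB mul1r.
have fg : cancel f g.
  apply: (lipschitz_dense_eq nF nF embF_dense (f := g \o f) (g := id)
    (k := 1) (k' := 1)) => [c c'|c c'|x] /=.
  - by rewrite (le_trans (g_lip _ _))// mul1r f_lip.
  - by rewrite mul1r.
  - by rewrite fE gE hk.
have gf : cancel g f.
  apply: (lipschitz_dense_eq nX nX embX_dense (f := f \o g) (g := id)
    (k := 1) (k' := 1)) => [c c'|c c'|x] /=.
  - by rewrite (le_trans (f_lip _ _))// mul1r g_lip.
  - by rewrite mul1r.
  - by rewrite gE fE kh.
(* A grading is a *-homomorphism, hence bounded; this lets the intertwining relation pass from the
   dense image to the completion. *)
have grading_lip (C : gradedCStarAlgType R) (c c' : C) :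
    cnorm (grading c - grading c') <= 2 * cnorm (c - c').
  rewrite -gradingN -gradingD; apply: star_hom_bounded; split.
  - exact: grading_linear.
  - exact: gradingM.
  - exact: grading1.
  - exact: grading_star.
(* As [u] is even, the grading of a u is that of [a] times [u], so the twist respects the gradings
   on homogeneous pure tensors. *)
have f_grading x : f (grading (fermi_emb F x)) = grading (f (fermi_emb F x)).
  move: x; apply: (tensor_ind (fermi_algP F)) => [x y xE yE|a b ha hb].
    by rewrite raddfD/= gradingD raddfD/= xE yE raddfD/= gradingD.
  rewrite fermi_grading !fE !hE; have [bO|[bE _]] := homogeneousP hb.
    rewrite !twisted_odd ?odd_grading//.
    rewrite min_grading gradingM.
    by rewrite (elimT (evenP _) (inner_grading_even uP)).
  by rewrite !twisted_even ?even_grading// min_grading.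
case: fP => fl fM f1 fS.
pose theta : {lrmorphism F -> X} :=
  HB.pack (f : F -> X) (GRing.isLinear.Build R[i] F X *:%R f fl)
    (GRing.isMonoidMorphism.Build F X f (f1, fM)).
exists theta; split=> //; first by exists g.
apply: (lipschitz_dense_eq nF nX embF_dense (f := fun c => f (grading c))
  (g := fun c => grading (f c)) (k := 2) (k' := 2)) => [c c'|c c'|x].
- by rewrite (le_trans (f_lip _ _))// mul1r grading_lip.
- by rewrite (le_trans (grading_lip _ _ _))// ler_wpM2l// -[leRHS]mul1r f_lip.
- exact: f_grading.
Qed.
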